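(* Let $(\Omega,\mu,d)$ be a metric measure space and let $X=L^p(\Omega)$ with $1\le p\le\infty$, or $X=\mathcal C_b(\Omega)$. Let $h\in L^\infty(\Omega)$ if $X=L^p(\Omega)$, and $h\in\mathcal C_b(\Omega)$ if $X=\mathcal C_b(\Omega)$. If $K\in\mathcal L(X,X)$ is compact, then $$\sigma(K-hI)=\overline{R(-h)}\cup\{\mu_n\}_{n=1}^M,\qquad\text{with }M\in\mathbb N\cup\{\infty\}.$$ If $M=\infty$, then $\{\mu_n\}_{n=1}^\infty$ is a sequence of eigenvalues of $K-hI$ with finite multiplicity that accumulates in $\overline{R(-h)}$.
   Context: A metric measure space $(\Omega,\mu,d)$ is a metric space $(\Omega,d)$ with a $\sigma$-finite, regular, complete Borel measure $\mu$ that associates a finite positive measure to the balls of $\Omega$. $\mathcal C_b(\Omega)$ is the space of bounded continuous functions with the sup norm. $hI$ is the multiplication operator $u\mapsto hu$ on $X$. $R(-h)$ denotes the range of the function $-h:\Omega\to\mathbb R$ and $\overline{R(-h)}$ its closure. $\sigma(\cdot)$ is the spectrum of an operator in $X$.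
   Formalization: Added: preimages under h of balls are null or not finite up to a null set (automatic if points are null); without it the claim fails for Ω one point, h=0, K=I. For h in L^∞ the closed range of -h is read as the essential range. *)

(* Defs.v *)
From HB Require Import structures.
From mathcomp Require Import all_boot all_order all_algebra.
From mathcomp Require Import all_classical all_reals all_analysis.
From mathcomp Require Import measurable_realfun ess_sup_inf complex.

Set Implicit Arguments.
Unset Strict Implicit.
Unset Printing Implicit Defensive.

Import Order.TTheory GRing.Theory Num.Theory.
Import numFieldNormedType.Exports.
Import Normc.

Local Open Scope classical_set_scope.
Local Open Scope complex_scope.
Local Open Scope ring_scope.

(* The sigma-algebra is not required to be the Borel one: a complete Borel
   measure lives on a sigma-algebra that contains the Borel sets. *)
#[short(type="metricMeasurableType")]
HB.structure Definition MetricMeasurable (R : numDomainType) d :=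
  {T of Metric R T & Measurable d T}.

(* With sigma-finiteness the usual variants (inner regularity by compact sets
   required on open sets only, or on all measurable sets) coincide. *)
Definition regular_measure (R : realType) d (T : metricMeasurableType R d)
    (mu : {measure set T -> \bar R}) : Prop :=
  forall A : set T, measurable A ->
    mu A = ereal_inf [set mu U | U in [set U | open U /\ A `<=` U]] /\
    mu A = ereal_sup [set mu C | C in [set C | compact C /\ C `<=` A]].

Record metric_measure (R : realType) d (T : metricMeasurableType R d)
    (mu : {measure set T -> \bar R}) : Prop := MetricMeasure {
  mm_borel : forall U : set T, open U -> measurable U ;
  mm_sigma_finite : sigma_finite [set: T] mu ;
  mm_regular : regular_measure mu ;
  mm_complete : measure_is_complete mu ;
  mm_ball : forall (x : T) (r : R), 0 < r -> (0 < mu (ball x r) < +oo)%E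
}.

Section normc_lemmas.
Context (R : realType).
Implicit Types a z w : R[i].

Lemma normcE z : normc z = Num.sqrt (complex.Re z ^+ 2 + complex.Im z ^+ 2).
Proof. by case: z. Qed.

Lemma normr_normc z : `|z| = (normc z)%:C.
Proof. by case: z. Qed.

Lemma normc_ge0 z : 0 <= normc z.
Proof. by rewrite normcE sqrtr_ge0. Qed.

Lemma ler_normcD z w : normc (z + w) <= normc z + normc w.
Proof. by have := ler_normD z w; rewrite !normr_normc -rmorphD lecR. Qed.

Lemma normc_real (r : R) : normc r%:C = `|r|.
Proof. by rewrite normcE /= expr0n /= addr0 sqrtr_sqr. Qed.

Lemma ReMD a z w : complex.Re (a * z + w) =
  complex.Re a * complex.Re z - complex.Im a * complex.Im z + complex.Re w.
Proof. by case: a z w => [? ?] [? ?] [? ?]. Qed.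

Lemma ImMD a z w : complex.Im (a * z + w) =
  complex.Re a * complex.Im z + complex.Im a * complex.Re z + complex.Im w.
Proof. by case: a z w => [? ?] [? ?] [? ?]. Qed.

End normc_lemmas.

Section Lnorm_lemmas.
Context d (T : measurableType d) (R : realType).
Variable mu : {measure set T -> \bar R}.
Local Open Scope ereal_scope.

Lemma ae_le_Lnorm (p : \bar R) (f g : T -> R) : 1 <= p ->
  measurable_fun [set: T] f -> measurable_fun [set: T] g ->
  {ae mu, forall x, (`|f x| <= `|g x|)%R} ->
  'N[mu]_p[EFin \o f] <= 'N[mu]_p[EFin \o g].
Proof.
move=> + mf mg fg; rewrite unlock /Lnorm; case: p => [r|_|//].
- rewrite lee_fin => r1; have r0 : (0 <= r)%R by exact: le_trans r1.
  have mpow (h : T -> R) : measurable_fun [set: T] h ->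
      measurable_fun [set: T] (@EFin R \o (fun x => (`|h x| `^ r)%R)).
    move=> mh; apply/measurable_EFinP.
    apply: (@measurableT_comp _ _ _ _ _ _ (@powR R ^~ r)) => //.
    exact: measurableT_comp.
  have int0 (h : T -> R) : \int[mu]_x `|(EFin \o h) x| `^ r \in `[0, +oo].
    by rewrite in_itv /= leey andbT integral_ge0// => x _; exact: poweR_ge0.
  apply: gt0_ler_poweR; rewrite ?invr_ge0 ?int0//.
  apply: ae_ge0_le_integral; [exact: measurableT| |exact: mpow| |exact: mpow|].
  + by move=> x _; exact: poweR_ge0.
  + by move=> x _; exact: poweR_ge0.
  apply: filterS fg => x fgx _.
  by rewrite gt0_ler_poweR// ?in_itv /= ?andbT ?leey ?lee_fin ?normr_ge0.
- case: ifPn => // _; apply: le_ess_sup.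
  by apply: filterS fg => x fgx /=; rewrite lee_fin.
Qed.

End Lnorm_lemmas.

Section LpC.
Context d (T : measurableType d) (R : realType).
Variables (mu : {measure set T -> \bar R}) (p : \bar R) (p1 : (1 <= p)%E).

Definition Lfunc_pred & (1 <= p)%E : {pred T -> R[i]} :=
  mem [set u : T -> R[i] |
    [/\ measurable_fun [set: T] (@complex.Re R \o u),
        measurable_fun [set: T] (@complex.Im R \o u) &
        finite_norm mu p (@normc R \o u)]].

Lemma measurable_normc (u : T -> R[i]) :
  measurable_fun [set: T] (@complex.Re R \o u) ->
  measurable_fun [set: T] (@complex.Im R \o u) ->
  measurable_fun [set: T] (@normc R \o u).
Proof.
move=> mr mi.
rewrite (_ : @normc R \o u = @Num.sqrt R \o
  (fun x => (@complex.Re R \o u) x ^+ 2 + (@complex.Im R \o u) x ^+ 2)); last first.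
  by apply/funext => x /=; rewrite normcE.
apply: measurableT_comp.
  by apply: continuous_measurable_fun; exact: sqrt_continuous.
by apply: measurable_funD; exact: measurable_funX.
Qed.

Lemma Lfunc_normc (u : T -> R[i]) :
  u \in Lfunc_pred p1 -> @normc R \o u \in Lfun mu p.
Proof.
rewrite inE => -[mr mi fu]; rewrite inE; apply/andP; split; rewrite inE//=.
exact: measurable_normc.
Qed.

Lemma Lfunc_submod_closed : submod_closed (Lfunc_pred p1).
Proof.
split=> [|a u v].
  rewrite inE; split; [exact: measurable_cst|exact: measurable_cst|].
  rewrite (_ : @normc R \o _ = cst 0); last first.
    by apply/funext => x /=; rewrite expr0n /= addr0 sqrtr0.
  exact: finite_norm_cst0.
move=> Hu Hv; have := Hu; have := Hv; rewrite !inE => -[vr vi vf] [ur ui uf].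
have mr : measurable_fun [set: T] (@complex.Re R \o (a *: u + v)).
  rewrite (_ : _ \o _ = fun x => complex.Re a * (@complex.Re R \o u) x -
      complex.Im a * (@complex.Im R \o u) x + (@complex.Re R \o v) x).
    by apply: measurable_funD => //; apply: measurable_funB;
       exact: measurable_funM.
  by apply/funext => x; exact: ReMD.
have mi : measurable_fun [set: T] (@complex.Im R \o (a *: u + v)).
  rewrite (_ : _ \o _ = fun x => complex.Re a * (@complex.Im R \o u) x +
      complex.Im a * (@complex.Re R \o u) x + (@complex.Im R \o v) x).
    by apply: measurable_funD => //; apply: measurable_funD;
       exact: measurable_funM.
  by apply/funext => x; exact: ImMD.
split=> //.
pose nu : LfunType mu p1 := Lfun_Sub p1 (Lfunc_normc Hu).
pose nv : LfunType mu p1 := Lfun_Sub p1 (Lfunc_normc Hv).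
pose w : LfunType mu p1 := normc a *: nu + nv.
apply: (@le_lt_trans _ _ 'N[mu]_p[EFin \o w]%E); last exact: Lfunction_finite.
apply: ae_le_Lnorm => //; first exact: measurable_normc.
apply: nearW => x; rewrite ger0_norm ?normc_ge0// ger0_norm.
  by rewrite /= (le_trans (ler_normcD _ _))// normcM.
by rewrite addr_ge0 ?mulr_ge0 ?normc_ge0.
Qed.

HB.instance Definition _ :=
  GRing.isSubmodClosed.Build R[i] (T -> R[i]) (Lfunc_pred p1) Lfunc_submod_closed.

Record Lfunc := LFunc { lfunc :> T -> R[i] ; lfuncP : lfunc \in Lfunc_pred p1 }.

HB.instance Definition _ := [isSub for lfunc].
HB.instance Definition _ := [Choice of Lfunc by <:].
HB.instance Definition _ := [SubChoice_isSubLmodule of Lfunc by <:].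

End LpC.

Arguments Lfunc {d T R} mu {p} p1.

Section LpC_quotient.
Context d (T : measurableType d) (R : realType).
Variables (mu : {measure set T -> \bar R}) (p : \bar R) (p1 : (1 <= p)%E).
Implicit Types u v : Lfunc mu p1.

Definition Lnull : {pred Lfunc mu p1} :=
  mem [set u : Lfunc mu p1 | {ae mu, forall x, u x = 0}].

Lemma Lnull_zmod_closed : zmod_closed Lnull.
Proof.
split=> [|u v]; first by rewrite inE; apply: nearW.
rewrite !inE /= => u0 v0; apply: filterS2 u0 v0 => x ux vx.
by rewrite -[LHS]/(u x - v x) ux vx subr0.
Qed.

HB.instance Definition _ :=
  GRing.isZmodClosed.Build (Lfunc mu p1) Lnull Lnull_zmod_closed.

Definition LpC : Type := Quotient.quot Lnull.

HB.instance Definition _ := GRing.Zmodule.on LpC.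
HB.instance Definition _ := Quotient.on LpC.

Local Open Scope quotient_scope.

Lemma eq_LpCP u v :
  (\pi_LpC u = \pi_LpC v) <-> {ae mu, forall x, u x = v x}.
Proof.
have E : (\pi_LpC u = \pi_LpC v) <-> (u - v \in Lnull).
  by rewrite Quotient.idealrBE; split => /eqP.
rewrite E inE /=; split; apply: filterS => x.
- by move=> /eqP; rewrite -[X in X == _]/(u x - v x) subr_eq0 => /eqP.
- by move=> uv; rewrite -[LHS]/(u x - v x) uv subrr.
Qed.

Lemma LpC_reprP u : {ae mu, forall x, (repr (\pi_LpC u) : Lfunc mu p1) x = u x}.
Proof. by apply/eq_LpCP; rewrite reprK. Qed.

Lemma LpC_piD u v : \pi_LpC (u + v) = \pi_LpC u + \pi_LpC v.
Proof. by rewrite [LHS]Quotient.pi_add. Qed.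

Definition scaleLpC (a : R[i]) (f : LpC) : LpC := \pi_LpC (a *: repr f).

Lemma LpC_piZ a u : \pi_LpC (a *: u) = scaleLpC a (\pi_LpC u).
Proof.
apply/eq_LpCP; apply: filterS (LpC_reprP u) => x ux.
by rewrite -[LHS]/(a * u x) -ux.
Qed.

Lemma scaleLpCA a b f : scaleLpC a (scaleLpC b f) = scaleLpC (a * b) f.
Proof. by rewrite -[f]reprK -(LpC_piZ b) -(LpC_piZ a) -LpC_piZ scalerA. Qed.

Lemma scaleLpC1 : left_id 1 scaleLpC.
Proof. by move=> f; rewrite -[f]reprK -!LpC_piZ scale1r. Qed.

Lemma scaleLpCDr : right_distributive scaleLpC +%R.
Proof.
by move=> a f g; rewrite -[f]reprK -[g]reprK -LpC_piD -(LpC_piZ a (_ + _))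
  -(LpC_piZ a (repr f)) -(LpC_piZ a (repr g)) -LpC_piD scalerDr.
Qed.

Lemma scaleLpCDl f : {morph scaleLpC^~ f : a b / a + b}.
Proof. by move=> a b; rewrite -[f]reprK -(LpC_piZ a) -(LpC_piZ b) -(LpC_piZ (a + b))
  -LpC_piD scalerDl. Qed.

HB.instance Definition _ := GRing.Zmodule_isLmodule.Build R[i] LpC
  scaleLpCA scaleLpC1 scaleLpCDr scaleLpCDl.

Definition modulus u : LfunType mu p1 := Lfun_Sub p1 (Lfunc_normc (lfuncP u)).

Definition normLpC (f : LpC) : R := fine 'N[mu]_p[EFin \o modulus (repr f)]%E.

Lemma normLpC_pi u : normLpC (\pi_LpC u) = fine 'N[mu]_p[EFin \o modulus u]%E.
Proof.
congr fine; apply/le_anti/andP; split; apply: ae_le_Lnorm => //;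
  by apply: filterS (LpC_reprP u) => x /= ->.
Qed.

Lemma normLpCE (f : LpC) : (normLpC f)%:E = 'N[mu]_p[EFin \o modulus (repr f)]%E.
Proof. exact: finite_norm_fine. Qed.

Lemma ler_normLpCD f g : (normLpC (f + g))%:C <= (normLpC f)%:C + (normLpC g)%:C.
Proof.
rewrite -rmorphD lecR -{1}[f]reprK -{1}[g]reprK -LpC_piD normLpC_pi.
apply: (le_trans _ (ler_LnormD (modulus (repr f)) (modulus (repr g)))).
rewrite -lee_fin !finite_norm_fine; apply: ae_le_Lnorm => //.
apply: nearW => x; rewrite ger0_norm ?normc_ge0// ger0_norm ?addr_ge0 ?normc_ge0//.
exact: ler_normcD.
Qed.

Lemma normLpCZ a f : (normLpC (a *: f))%:C = `|a| * (normLpC f)%:C.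
Proof.
rewrite normr_normc -rmorphM; congr (_ %:C).
rewrite (_ : a *: f = \pi_LpC (a *: repr f))// normLpC_pi.
apply: EFin_inj; rewrite finite_norm_fine EFinM normLpCE.
rewrite -[normc a](ger0_norm (normc_ge0 a)) -LnormZ.
by apply: eq_Lnorm => x /=; rewrite normcM.
Qed.

Lemma normLpC_eq0 f : (normLpC f)%:C = 0 -> f = 0.
Proof.
move=> /complexI /fine_Lnormr_eq0 f0.
rewrite -[f]reprK (_ : 0 = \pi_LpC 0); last by rewrite pi_zeror.
apply/eq_LpCP; apply: filterS f0 => x /= /(_ I); exact: eq0_normc.
Qed.

HB.instance Definition _ := @Lmodule_isNormed.Build R[i] LpC
  (fun f => (normLpC f)%:C) ler_normLpCD normLpCZ normLpC_eq0.

Lemma normr_LpCE (f : LpC) : `|f| = (normLpC f)%:C.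
Proof. by []. Qed.

End LpC_quotient.

Arguments LpC {d T R} mu {p} p1.

Section mulLp.
Context d (T : measurableType d) (R : realType).
Variables (mu : {measure set T -> \bar R}) (p : \bar R) (p1 : (1 <= p)%E).
Variable h : LfunType mu (leey 1).
Implicit Types u : Lfunc mu p1.

Lemma mul_Lfunc_subproof u : (fun x => (h x)%:C * u x) \in Lfunc_pred mu p1.
Proof.
have := lfuncP u; rewrite inE => -[ur ui uf].
have mh : measurable_fun [set: T] h by [].
have mr : measurable_fun [set: T] (@complex.Re R \o (fun x => (h x)%:C * u x)).
  rewrite (_ : _ \o _ = fun x => h x * (@complex.Re R \o u) x).
    exact: measurable_funM.
  by apply/funext => x /=; case: (u x) => a b /=; rewrite mul0r subr0.
have mi : measurable_fun [set: T] (@complex.Im R \o (fun x => (h x)%:C * u x)).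
  rewrite (_ : _ \o _ = fun x => h x * (@complex.Im R \o u) x).
    exact: measurable_funM.
  by apply/funext => x /=; case: (u x) => a b /=; rewrite mul0r addr0.
rewrite inE; split=> //.
pose c := fine 'N[mu]_+oo[EFin \o h]%E.
pose w : LfunType mu p1 := c *: modulus u.
apply: (@le_lt_trans _ _ 'N[mu]_p[EFin \o w]%E); last exact: Lfunction_finite.
apply: ae_le_Lnorm => //; first exact: measurable_normc.
have hc : {ae mu, forall x, `|h x| <= c}.
  have [mu0|mu0] := ltP 0%E (mu [set: T]); last first.
    exists [set: T]; split=> //.
    by apply/eqP; rewrite -measure_le0.
  have := @ess_sup_ge _ _ _ mu (abse \o (EFin \o h)).
  apply: filterS => x; rewrite -lee_fin /c finite_norm_fine.
  by rewrite unlock /Lnorm mu0.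
apply: filterS hc => x hx.
rewrite ger0_norm ?normc_ge0// (le_trans _ (ler_norm _))//= normcM normc_real.
by rewrite ler_wpM2r ?normc_ge0.
Qed.

Definition mul_Lfunc u : Lfunc mu p1 := LFunc (mul_Lfunc_subproof u).

Local Open Scope quotient_scope.

Definition mulLp (f : LpC mu p1) : LpC mu p1 := \pi_(LpC mu p1) (mul_Lfunc (repr f)).

Lemma mulLp_pi u : mulLp (\pi_(LpC mu p1) u) = \pi_(LpC mu p1) (mul_Lfunc u).
Proof. by apply/eq_LpCP; apply: filterS (LpC_reprP u) => x /= ->. Qed.

End mulLp.

Section Cb.
Context (T : topologicalType) (K : numFieldType).

Definition Cb_pred : {pred T -> K} :=
  mem [set f : T -> K |
    continuous (f : T -> K^o) /\ exists M : K, forall x, `|f x| <= M].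

Lemma Cb_submod_closed : submod_closed Cb_pred.
Proof.
split=> [|a f g].
  rewrite inE; split; first by move=> x; exact: cvg_cst.
  by exists 0 => x; rewrite normr0.
rewrite !inE => -[cf [M fM]] [cg [N gN]]; split.
  move=> x; apply: (@cvgD K K^o); last exact: cg.
  by apply: (@cvgZl_tmp K K^o); exact: cf.
exists (`|a| * M + N) => x; rewrite (le_trans (ler_normD _ _))// lerD//.
by rewrite normrM ler_wpM2l.
Qed.

HB.instance Definition _ :=
  GRing.isSubmodClosed.Build K (T -> K) Cb_pred Cb_submod_closed.

Record Cb := BCont { cbfun :> T -> K ; cbfunP : cbfun \in Cb_pred }.

HB.instance Definition _ := [isSub for cbfun].
HB.instance Definition _ := [Choice of Cb by <:].
HB.instance Definition _ := [SubChoice_isSubLmodule of Cb by <:].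

End Cb.

Section Cb_norm.
Context (T : topologicalType) (R : realType).
Implicit Types u v : Cb T R[i].

Definition normCb u : R := sup [set normc (u x) | x in [set: T]].

Lemma normCb_ubound u : has_ubound [set normc (u x) | x in [set: T]].
Proof.
have := cbfunP u; rewrite inE => -[_ [M uM]]; exists (complex.Re M) => _ [x _ <-].
by have := uM x; rewrite normr_normc; case: M {uM} => a b /andP[].
Qed.

Lemma normCb_ge u x : normc (u x) <= normCb u.
Proof. by apply: ub_le_sup; [exact: normCb_ubound|exists x]. Qed.

Lemma normCb_le u (M : R) : 0 <= M -> (forall x, normc (u x) <= M) -> normCb u <= M.
Proof.
move=> M0 uM; rewrite /normCb; set A := (X in sup X).
have [[y Ay]|/set0P/negP/negPn/eqP ->] := pselect (A !=set0); last by rewrite sup0.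
by apply: ge_sup; [exists y|move=> _ [x _ <-]].
Qed.

Lemma normCb_ge0 u : 0 <= normCb u.
Proof.
rewrite /normCb; set A := (X in sup X).
have [[y Ay]|/set0P/negP/negPn/eqP ->] := pselect (A !=set0); last by rewrite sup0.
by case: Ay => x _ _; exact: le_trans (normc_ge0 (u x)) (normCb_ge u x).
Qed.

Lemma ler_normCbD u v : (normCb (u + v))%:C <= (normCb u)%:C + (normCb v)%:C.
Proof.
rewrite -rmorphD lecR; apply: normCb_le; first by rewrite addr_ge0 ?normCb_ge0.
by move=> x; rewrite (le_trans (ler_normcD _ _))// lerD ?normCb_ge.
Qed.

Lemma normCbZ a u : (normCb (a *: u))%:C = `|a| * (normCb u)%:C.
Proof.
rewrite normr_normc -rmorphM; congr (_ %:C).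
have aM b (w : Cb T R[i]) : normCb (b *: w) <= normc b * normCb w.
  apply: normCb_le => [|x]; first by rewrite mulr_ge0 ?normc_ge0 ?normCb_ge0.
  by rewrite [X in X <= _]normcM ler_wpM2l ?normc_ge0 ?normCb_ge.
have [->|a0] := eqVneq a 0.
  rewrite scale0r normc0 mul0r; apply/le_anti; rewrite normCb_ge0 andbT.
  by apply: normCb_le => // x; rewrite normc0.
apply/le_anti; rewrite aM/=.
have na0 : 0 < normc a.
  by rewrite lt_neqAle normc_ge0 andbT eq_sym; apply: contra a0 => /eqP/eq0_normc ->.
rewrite -ler_pdivlMl// -normcV.
by have := aM a^-1 (a *: u); rewrite scalerA mulVf// scale1r.
Qed.

Lemma normCb_eq0 u : (normCb u)%:C = 0 -> u = 0.
Proof.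
move=> /complexI u0; apply/val_inj/funext => x; apply: eq0_normc.
by apply/le_anti; rewrite normc_ge0 andbT -u0 normCb_ge.
Qed.

HB.instance Definition _ := @Lmodule_isNormed.Build R[i] (Cb T R[i])
  (fun u => (normCb u)%:C) ler_normCbD normCbZ normCb_eq0.

Lemma normr_CbE u : `|u| = (normCb u)%:C.
Proof. by []. Qed.

Variable h : Cb T R.

Lemma mulCb_subproof u : (fun x => (h x)%:C * u x) \in @Cb_pred T R[i].
Proof.
have := cbfunP h; have := cbfunP u; rewrite !inE => -[cu [M uM]] [ch [N hN]].
split; last first.
  exists (N%:C * M) => x; rewrite normrM; apply: ler_pM; [by []|by []| |exact: uM].
  by rewrite normr_normc lecR normc_real.
move=> x; apply: (@cvgM R[i]); last exact: cu.
apply/(@cvgrPdist_lt _ R[i]^o) => -[e1 e2]; rewrite ltcE/= => /andP[/eqP -> e0].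
near=> t; rewrite -rmorphB normr_normc ltcR normc_real.
by near: t; move/cvgrPdist_lt: (ch x); exact.
Unshelve. all: by end_near. Qed.

Definition mulCb u : Cb T R[i] := BCont (mulCb_subproof u).

End Cb_norm.

Section operators.
Context (R : realType) (V : normedModType R[i]).
Implicit Types (A : V -> V) (z : R[i]).

Definition compact_operator A : Prop :=
  forall B : set V, bounded_set B -> precompact (A @` B).

Definition resolvent_set A : set R[i] := [set z | exists S : {linear V -> V},
  [/\ continuous S, (forall u, S (A u - z *: u) = u) &
      forall u, A (S u) - z *: S u = u]].

Definition spectrum A : set R[i] := ~` resolvent_set A.

Definition eigenvalue_op A z : Prop := exists2 u, u != 0 & A u = z *: u.

Definition root_space A z : set V :=
  [set u | exists k : nat, iter k (fun v => A v - z *: v) u = 0].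

Definition finite_dimensional (E : set V) : Prop :=
  exists (n : nat) (e : 'I_n -> V), forall u, E u ->
    exists c : 'I_n -> R[i], u = \sum_(i < n) c i *: e i.

(* Multiplicity is algebraic multiplicity; the root space contains the
   eigenspace, so the geometric multiplicity is finite as well. *)
Definition eigenvalue_finite_mult A z : Prop :=
  eigenvalue_op A z /\ finite_dimensional (root_space A z).

(* [M = None] encodes an infinite sequence, [M = Some m] the m terms
   z 0, ..., z (m - 1). *)
Definition index_set (M : option nat) : set nat :=
  if M is Some m then [set n | (n < m)%N] else [set: nat].

Definition spectrum_description A (Rh : set R) : Prop :=
  exists (M : option nat) (z : nat -> R[i]),
    [/\ set_inj (index_set M) z,
        spectrum A = [set r%:C | r in Rh] `|` z @` index_set M &
        M = None ->
          (forall n, eigenvalue_finite_mult A (z n)) /\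
          (let C := cluster ((z : nat -> R[i]^o) @ \oo) in
           C !=set0 /\ C `<=` [set r%:C | r in Rh])].

End operators.

Section ranges.
Context (R : realType) d (T : metricMeasurableType R d).
Variable mu : {measure set T -> \bar R}.

(* For a class in L^oo the closure of the range is only meaningful as the
   essential range, which is a closed set. *)
Definition ess_range (f : T -> R) : set R :=
  [set y | forall e : R, 0 < e -> (0 < mu (f @^-1` ball y e))%E].

(* No value of h is carried by finitely many points of positive mass: a
   preimage of a ball under h is either null or not a finite set up to a null
   set. If this fails for h^-1(ball y e), then L^p(h^-1(ball y e)) is nonzero
   and finite-dimensional, -h has there an isolated eigenvalue of finite
   multiplicity, and a finite rank operator K can remove it from the spectrum
   of K - hI, so that the closed range of -h is no longer contained in it. The
   condition holds for every measurable h if points are null sets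
   (nonatomic_no_finite_level). *)
Definition no_finite_level (h : T -> R) : Prop :=
  forall y e : R, 0 < e -> (0 < mu (h @^-1` ball y e))%E ->
    ~ exists F : set T, finite_set F /\ mu.-negligible (h @^-1` ball y e `\` F).

Lemma nonatomic_no_finite_level (h : T -> R) : metric_measure mu ->
  measurable_fun [set: T] h -> (forall x, mu [set x] = 0) -> no_finite_level h.
Proof.
move=> hmu mh mu0 y e e0 + [F [/finite_seqP[s ->] nF]].
apply/negP; rewrite -leNgt le_eqVlt; apply/orP; left; apply/eqP.
have mA : measurable (h @^-1` ball y e).
  by rewrite -[X in measurable X]setTI; apply: mh => //; exact: measurable_ball.
apply/(negligibleP mu mA).
have AsF : h @^-1` ball y e `<=` (h @^-1` ball y e `\` [set` s]) `|` [set` s].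
  by move=> x Ax; have [xs|xs] := pselect ([set` s] x); [right|left].
apply: (negligibleS AsF); apply: negligibleU => // {nF AsF}.
elim: s => [|x s ih]; first by rewrite set_nil; exact: negligible_set0.
have xsU : [set` x :: s] `<=` [set x] `|` [set` s].
  by move=> z /=; rewrite inE => /orP[/eqP ->|zs]; [left|right].
apply: (negligibleS xsU); apply: negligibleU => //; exists [set x]; split; [|exact: mu0|by []].
rewrite -[X in measurable X]setCK; apply: measurableC; apply: (mm_borel hmu).
exact/closed_openC/accessible_closed_set1/hausdorff_accessible/metric_hausdorff.
Qed.

End ranges.

(* Main.v *)
From HB Require Import structures.
Require Import Defs.
From mathcomp Require Import finmap.
From mathcomp Require Import all_boot all_order all_algebra.
From mathcomp Require Import all_classical all_reals all_analysis.
From mathcomp Require Import measurable_realfun ess_sup_inf complex ring lra.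

(** Write [T z = K - H - z] for the operator [H] of multiplication by [h]. Both
    parts follow from one theorem on normed spaces
    ([compact_minus_multiplication_spectrum]). There [H] is any bounded operator
    and the range any closed set of reals such that [H + z] has a bounded
    inverse when [z] is off the range, and such that the points of the range
    belong to the spectrum of [K - H].

    Off the range, [T z] is a compact perturbation of an invertible operator.
    By the Fredholm alternative ([compact_perturbation_surj]) such a [z] is in
    the resolvent set unless it is an eigenvalue, so the whole point is that
    eigenvalues do not accumulate off the range. The usual argument is the
    analytic Fredholm theorem; the following one needs no function theory. If
    eigenvalues accumulate at [z], a limit of unit eigenvectors is a vector of
    the kernel of [T z] that lies in the range of every power of [T z]
    ([eigenvalue_limit_kernel_meets_ranges]). Such a vector [v_0] starts a chain
    [T z v_(k+1) = v_k] of geometric growth, and [\sum_k zeta ^+ k *: v_k] is an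
    eigenvector for [z + zeta] for all small [zeta]
    ([kernel_meets_ranges_open]): eigenvalues fill a neighbourhood of [z]. As
    the range is real, a vertical ray leaves [z] without meeting it. The set of
    points of this ray near which all points are eigenvalues is open and closed
    in the ray, hence the whole ray, which contradicts the boundedness of the
    eigenvalues ([eigenvalues_isolated]). The same lemma excludes infinite
    ascent, so root spaces are finite-dimensional ([root_space_finite]).
    Isolation off a closed set together with boundedness gives countability and
    accumulation in the range only.

    A point [r] of the range is in the spectrum because, for every [e], there
    are arbitrarily many unit vectors with mutual distances at least one on
    which [H + r] has norm at most [e] ([approximate_spectrum]). In [L^p] they
    are normalised indicators of disjoint sets; the condition [no_finite_level]
    and the inner regularity of the measure provide infinitely many points near
    which the set where [h] is close to [- r] has positive mass. For bounded
    continuous functions they are bump functions.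

    Limits are taken along one ultrafilter [U] on the naturals that refines the
    convergence to infinity. Compactness then gives limits of whole sequences,
    and [proper_op], the statement that bounded approximate solutions converge
    along [U], carries the Fredholm theory without completeness. *)

Set Implicit Arguments.
Unset Strict Implicit.
Unset Printing Implicit Defensive.

Import Order.TTheory GRing.Theory Num.Theory.
Import numFieldNormedType.Exports.
Import Normc.

Local Open Scope classical_set_scope.
Local Open Scope complex_scope.
Local Open Scope ring_scope.

(** * Real-valued norms and limits along an ultrafilter *)

Section real_norm.
Context (R : realType) (V : normedModType R[i]).
Implicit Types x y : V.

(** The norm of a complex normed space takes values in [R[i]], whose order is
    only partial; infima and suprema of norms need this real-valued copy. *)
Definition rnorm x : R := complex.Re `|x|.

Lemma rnormE x : `|x| = (rnorm x)%:C.
Proof.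
rewrite /rnorm; have := normr_ge0 x.
by case: (`|x|) => a b; rewrite lecE /= => /andP[/eqP -> _].
Qed.

Lemma rnorm_ge0 x : 0 <= rnorm x.
Proof. by have := normr_ge0 x; rewrite rnormE -[0]/(0%:C) lecR. Qed.

Lemma rnorm0 : rnorm 0 = 0.
Proof. by rewrite /rnorm normr0. Qed.

Lemma rnorm_eq0 x : rnorm x = 0 -> x = 0.
Proof. by move=> x0; apply: normr0_eq0; rewrite rnormE x0. Qed.

Lemma rnorm_gt0 x : x != 0 -> 0 < rnorm x.
Proof.
move=> x0; rewrite lt_neqAle rnorm_ge0 andbT eq_sym.
by apply: contra x0 => /eqP/rnorm_eq0 ->.
Qed.

Lemma rnormN x : rnorm (- x) = rnorm x.
Proof. by rewrite /rnorm normrN. Qed.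

Lemma rnormC x y : rnorm (x - y) = rnorm (y - x).
Proof. by rewrite -rnormN opprB. Qed.

Lemma rnormD x y : rnorm (x + y) <= rnorm x + rnorm y.
Proof. by have := ler_normD x y; rewrite !rnormE -rmorphD lecR. Qed.

Lemma rnormB x y : rnorm (x - y) <= rnorm x + rnorm y.
Proof. by rewrite -(rnormN y) rnormD. Qed.

Lemma rnorm_trg z x y : rnorm (x - y) <= rnorm (x - z) + rnorm (z - y).
Proof. by rewrite -{1}[x](subrK z) -addrA rnormD. Qed.

Lemma rnormZ a x : rnorm (a *: x) = normc a * rnorm x.
Proof.
apply: complexI; rewrite -rnormE normrZ normr_normc rnormE.
by rewrite -rmorphM.
Qed.

End real_norm.

Section ultralimits.
Context (R : realType) (U : set_system nat).
Hypothesis UU : UltraFilter U.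
Hypothesis Uoo : \oo `<=` U.

#[local] Instance ultra_filter : Filter U.
Proof. by have [[]] := UU. Qed.

Lemma ultra_ex (A : set nat) : U A -> exists n, A n.
Proof. by move=> UA; have [n An] := filter_ex UA; exists n. Qed.

Lemma ultra_ge N : U [set n | (N <= n)%N].
Proof. by apply: Uoo; exact: nbhs_infty_ge. Qed.

Lemma ultra_pair (A : set nat) (f : nat -> nat) :
  U A -> exists n m, [/\ A n, A m & (f n <= m)%N].
Proof.
move=> UA; have [n An] := ultra_ex UA.
have [m [Am nm]] := ultra_ex (filterI UA (ultra_ge (f n))).
by exists n, m.
Qed.

Lemma ultra_invn (e : R) : 0 < e -> U [set n | n.+1%:R^-1 < e].
Proof.
by move=> e0; apply: Uoo; have := @near_infty_natSinv_lt R (PosNum e0).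
Qed.

Lemma ultra_fmap (T : Type) (s : nat -> T) : UltraFilter (s @ U).
Proof.
split=> [|G GF sUG]; first exact: fmap_proper_filter.
apply/seteqP; split=> // A GA.
have [//|UnA] := in_ultra_setVsetC (s @^-1` A) UU.
have GnA : G (~` A) by apply: sUG.
by have [x []] := filter_ex (filterI GA GnA).
Qed.

Section normed.
Context (V : normedModType R[i]).
Implicit Types (s t : nat -> V) (x y : V).

Definition ulim s x := forall e : R, 0 < e -> U [set n | rnorm (s n - x) < e].

Lemma ulim_le s x (a : nat -> R) :
  (forall n, rnorm (s n - x) <= a n) ->
  (forall e, 0 < e -> U [set n | a n < e]) -> ulim s x.
Proof.
by move=> sa a0 e /a0; apply: filterS => n; exact: le_lt_trans (sa n).
Qed.

Lemma ulim_near s t x : U [set n | s n = t n] -> ulim s x -> ulim t x.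
Proof.
move=> st sx e e0; have := sx e e0; apply: filterS2 st => n /= ->; exact.
Qed.

Lemma ulim_cst x : ulim (fun=> x) x.
Proof. by move=> e e0; apply: filterE => n; rewrite /= subrr rnorm0. Qed.

Lemma ulimD s t x y : ulim s x -> ulim t y -> ulim (fun n => s n + t n) (x + y).
Proof.
move=> sx ty e e0; have e20 : 0 < e / 2 by rewrite divr_gt0.
apply: filterS2 (sx _ e20) (ty _ e20) => n /= sn tn.
by rewrite opprD addrACA (le_lt_trans (rnormD _ _))// (splitr e) ltrD.
Qed.

Lemma ulimN s x : ulim s x -> ulim (fun n => - s n) (- x).
Proof. by move=> sx e /sx; apply: filterS => n /=; rewrite -opprD rnormN. Qed.

Lemma ulimB s t x y : ulim s x -> ulim t y -> ulim (fun n => s n - t n) (x - y).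
Proof. by move=> sx ty; exact/(ulimD sx)/ulimN. Qed.

Lemma ulim_norm_ge s x (c : R) : ulim s x -> U [set n | c <= rnorm (s n)] ->
  c <= rnorm x.
Proof.
move=> sx sc; apply/ler_addgt0Pr => e /sx /(filterI sc)/ultra_ex[n /= [cn sn]].
rewrite (le_trans cn)// -{1}[s n](subrK x) addrC.
by rewrite (le_trans (rnormD _ _))// lerD// ltW.
Qed.

Lemma ulim_norm_le s x (c : R) : ulim s x -> (forall n, rnorm (s n) <= c) ->
  rnorm x <= c.
Proof.
move=> sx sc; apply/ler_addgt0Pr => e /sx/ultra_ex[n /= sn].
rewrite -[x](subrK (s n)) addrC (le_trans (rnormD _ _))// lerD//.
by rewrite rnormC ltW.
Qed.

Lemma ulim_uniq s x y : ulim s x -> ulim s y -> x = y.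
Proof.
move=> sx sy; apply/subr0_eq/rnorm_eq0/le_anti; rewrite rnorm_ge0 andbT.
apply: (ulim_norm_le (ulimB sx sy)) => n.
by rewrite subrr rnorm0.
Qed.

Lemma ulim_cauchy s x (f : nat -> nat) (e : R) : ulim s x -> 0 < e ->
  exists n m, (f n <= m)%N /\ rnorm (s m - s n) < e.
Proof.
move=> sx e0; have e20 : 0 < e / 2 by rewrite divr_gt0.
have [n [m [/= sn sm nm]]] := ultra_pair f (sx _ e20).
exists n, m; split=> //; rewrite (le_lt_trans (rnorm_trg x _ _))//.
by rewrite (splitr e) ltrD// rnormC.
Qed.

(** Along an ultrafilter, compactness yields limits with no passage to a
    subsequence. *)
Lemma compact_ulim (C : set V) s : compact C -> (forall n, C (s n)) ->
  exists2 x, C x & ulim s x.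
Proof.
rewrite compact_ultra => cC sC.
have sUC : (s @ U) C by apply: (@filterE _ U) => n; exact: sC.
have [x [Cx sx]] := cC _ (ultra_fmap s) sUC; exists x => // e e0.
have e0' : (0 : R[i]) < e%:C by rewrite ltcR.
have Us : U [set n | `|x - s n| < e%:C] :=
  @cvgr_dist_lt _ _ _ U ultra_filter s x sx _ e0'.
by apply: filterS Us => n /=; rewrite rnormE ltcR rnormC.
Qed.

End normed.

Lemma real_bounded_ulim (r : nat -> R) (M : R) :
  (forall n, `|r n| <= M) ->
  exists l, forall e, 0 < e -> U [set n | `|r n - l| < e].
Proof.
move=> rM; have := @segment_compact R (- M) M; rewrite compact_ultra.
have rUC : (r @ U) `[- M, M]%classic.
  by apply: (@filterE _ U) => n /=; rewrite in_itv /= -ler_norml.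
move=> /(_ _ (ultra_fmap r) rUC)[l [_ rl]]; exists l => e e0.
have Ur : U [set n | `|l - r n| < e] :=
  @cvgr_dist_lt _ _ _ U ultra_filter r l rl _ e0.
by apply: filterS Ur => n /=; rewrite distrC.
Qed.

Lemma rnorm_complex (z : R[i]^o) : rnorm z = normc z.
Proof. by rewrite /rnorm normr_normc. Qed.

Lemma normc_le_ReIm (z : R[i]) : normc z <= `|complex.Re z| + `|complex.Im z|.
Proof.
rewrite Defs.normcE.
apply: (@le_trans _ _ (Num.sqrt ((`|complex.Re z| + `|complex.Im z|) ^+ 2))).
  rewrite ler_sqrt ?sqr_ge0// sqrrD !real_normK ?num_real//.
  by rewrite lerD2r lerDl mulrn_wge0// mulr_ge0.
by rewrite sqrtr_sqr ger0_norm// addr_ge0.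
Qed.

Lemma Re_le_normc (z : R[i]) : `|complex.Re z| <= normc z.
Proof. by have := normc_ge_Re z; rewrite normr_normc lecR. Qed.

Lemma Im_le_normc (z : R[i]) : `|complex.Im z| <= normc z.
Proof.
rewrite Defs.normcE -sqrtr_sqr ler_sqrt ?addr_ge0 ?sqr_ge0//.
by rewrite lerDr sqr_ge0.
Qed.

Lemma complex_bounded_ulim (z : nat -> R[i]^o) (M : R) :
  (forall n, normc (z n) <= M) -> exists l, ulim z l.
Proof.
move=> zM.
have [n|a za] := @real_bounded_ulim (fun n => complex.Re (z n)) M.
  exact: le_trans (Re_le_normc _) (zM n).
have [n|b zb] := @real_bounded_ulim (fun n => complex.Im (z n)) M.
  exact: le_trans (Im_le_normc _) (zM n).
exists (a +i* b)%C => e e0; have e20 : 0 < e / 2 by rewrite divr_gt0.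
apply: filterS2 (za _ e20) (zb _ e20) => n /= an bn.
rewrite rnorm_complex (le_lt_trans (normc_le_ReIm _))// (splitr e).
by case: (z n) an bn => u v /= an bn; rewrite ltrD.
Qed.

End ultralimits.

(** * Bounded and proper operators *)

Section bounded_operators.
Context (R : realType) (V : normedModType R[i]).
Implicit Types (L M : V -> V) (x y : V) (E F : set V).

Definition bounded_op L : Prop := linear L /\
  exists2 c : R, 0 <= c & forall x, rnorm (L x) <= c * rnorm x.

Lemma lin0 L : linear L -> L 0 = 0.
Proof.
move=> lL; have := lL 1 0 0; rewrite !scale1r addr0 => /eqP.
by rewrite -subr_eq subrr => /eqP.
Qed.

Lemma linD L x y : linear L -> L (x + y) = L x + L y.
Proof. by move=> lL; have := lL 1 x y; rewrite !scale1r. Qed.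

Lemma linZ L a x : linear L -> L (a *: x) = a *: L x.
Proof. by move=> lL; have := lL a x 0; rewrite (lin0 lL) !addr0. Qed.

Lemma linN L x : linear L -> L (- x) = - L x.
Proof. by move=> lL; rewrite -scaleN1r linZ// scaleN1r. Qed.

Lemma linB L x y : linear L -> L (x - y) = L x - L y.
Proof. by move=> lL; rewrite linD// linN. Qed.

Lemma bounded_op_id : bounded_op id.
Proof. by split => //; exists 1 => // x; rewrite mul1r. Qed.

Lemma bounded_opZ a L : bounded_op L -> bounded_op (fun x => a *: L x).
Proof.
move=> [lL [c c0 Lc]]; split=> [b x y|].
  by rewrite lL scalerDr !scalerA mulrC.
exists (normc a * c) => [|x]; first by rewrite mulr_ge0 ?normc_ge0.
by rewrite rnormZ -mulrA ler_wpM2l ?normc_ge0.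
Qed.

Lemma bounded_opB L M : bounded_op L -> bounded_op M ->
  bounded_op (fun x => L x - M x).
Proof.
move=> [lL [c c0 Lc]] [lM [d d0 Md]]; split=> [b x y|].
  by rewrite lL lM scalerBr opprD addrACA.
exists (c + d) => [|x]; first by rewrite addr_ge0.
by rewrite (le_trans (rnormB _ _))// mulrDl lerD.
Qed.

Lemma bounded_op_comp L M : bounded_op L -> bounded_op M ->
  bounded_op (fun x => L (M x)).
Proof.
move=> [lL [c c0 Lc]] [lM [d d0 Md]]; split=> [b x y|].
  by rewrite lM lL.
exists (c * d) => [|x]; first by rewrite mulr_ge0.
by rewrite (le_trans (Lc _))// -mulrA ler_wpM2l.
Qed.

Lemma bounded_op_iter L k : bounded_op L -> bounded_op (fun x => iter k L x).
Proof.
move=> bL; elim: k => [|k ih]; first exact: bounded_op_id.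
exact: (bounded_op_comp bL ih).
Qed.

Definition subspace E : Prop :=
  E 0 /\ forall a x y, E x -> E y -> E (a *: x + y).

Lemma subspaceD E x y : subspace E -> E x -> E y -> E (x + y).
Proof. by move=> [_ sE] Ex Ey; have := sE 1 x y Ex Ey; rewrite scale1r. Qed.

Lemma subspaceZ E a x : subspace E -> E x -> E (a *: x).
Proof. by move=> [E0 sE] Ex; have := sE a x 0 Ex E0; rewrite addr0. Qed.

Lemma subspaceN E x : subspace E -> E x -> E (- x).
Proof. by move=> sE Ex; rewrite -scaleN1r; apply: subspaceZ. Qed.

Lemma subspaceB E x y : subspace E -> E x -> E y -> E (x - y).
Proof. by move=> sE Ex Ey; apply: subspaceD => //; apply: subspaceN. Qed.

Lemma subspaceI E F : subspace E -> subspace F -> subspace (E `&` F).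
Proof.
move=> [E0 sE] [F0 sF]; split=> // a x y [Ex Fx] [Ey Fy].
by split; [apply: sE|apply: sF].
Qed.

Lemma subspace_ker L : linear L -> subspace [set x | L x = 0].
Proof.
move=> lL; split=> [|a x y /= x0 y0] /=; first exact: lin0.
by rewrite lL x0 y0 scaler0 addr0.
Qed.

Lemma subspace_range L : linear L -> subspace (range L).
Proof.
move=> lL; split=> [|a _ _ [x _ <-] [y _ <-]]; first by exists 0; rewrite ?lin0.
by exists (a *: x + y) => //; exact: lL.
Qed.

End bounded_operators.

Section properness.
Context (R : realType) (U : set_system nat).
Hypothesis UU : UltraFilter U.
Hypothesis Uoo : \oo `<=` U.
Context (V : normedModType R[i]).
Implicit Types (L M : V -> V) (s : nat -> V) (x y : V) (E F X : set V).

Lemma ulim_op L s x : bounded_op L -> ulim U s x ->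
  ulim U (fun n => L (s n)) (L x).
Proof.
move=> [lL [c c0 Lc]] sx e e0.
have d0 : 0 < e / (c + 1) by rewrite divr_gt0// ltr_wpDl.
have UF := ultra_filter UU; apply: filterS (sx _ d0) => n /= sn.
rewrite -linB// (le_lt_trans (Lc _))//.
rewrite (@le_lt_trans _ _ ((c + 1) * rnorm (s n - x)))//.
  by rewrite ler_wpM2r ?rnorm_ge0// lerDl.
by rewrite mulrC -ltr_pdivlMr// ltr_wpDl.
Qed.

Definition uclosed E : Prop :=
  forall s x, (forall n, E (s n)) -> ulim U s x -> E x.

Lemma uclosedI E F : uclosed E -> uclosed F -> uclosed (E `&` F).
Proof.
move=> cE cF s x EFs sx; split; [apply: cE sx|apply: cF sx];
  by move=> n; case: (EFs n).
Qed.

Lemma uclosed_ker L : bounded_op L -> uclosed [set x | L x = 0].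
Proof.
move=> bL s x s0 sx; apply: (ulim_uniq UU (ulim_op bL sx)).
by move=> e e0; apply: (@filterE _ _ (ultra_filter UU)) => n /=;
  rewrite s0 subrr rnorm0.
Qed.

(** The form of the Fredholm property used throughout: every bounded solution
    sequence of a convergent equation converges along the ultrafilter. It is
    stable under composition, and it yields closed range and a
    finite-dimensional kernel in every normed space. *)
Definition proper_op L : Prop := forall s (c : R) y,
  (forall n, rnorm (s n) <= c) -> ulim U (fun n => L (s n)) y ->
  exists x, ulim U s x.

Lemma proper_op_id : proper_op id.
Proof. by move=> s c y _ sy; exists y. Qed.

Lemma proper_op_comp L M : proper_op L -> proper_op M -> bounded_op M ->
  proper_op (fun x => L (M x)).
Proof.
move=> pL pM [_ [d d0 Md]] s c y sc Ly.
have [|z Mz] := pL (fun n => M (s n)) (d * c) y _ Ly; last exact: pM Mz.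
by move=> n; rewrite (le_trans (Md _))// ler_wpM2l.
Qed.

Lemma proper_op_iter L k : bounded_op L -> proper_op L ->
  proper_op (fun x => iter k L x).
Proof.
move=> bL pL; elim: k => [|k ih]; first exact: proper_op_id.
by apply: (proper_op_comp pL ih); exact: bounded_op_iter.
Qed.

(** If preimages of almost minimal norm were not controlled, rescaling them to
    norm about one would give a sequence that converges to an element of the
    kernel; subtracting that element would beat the minimal norm. *)
Lemma proper_op_lift L : bounded_op L -> proper_op L ->
  exists2 c : R, 0 < c &
    forall x, exists2 x', L x' = L x & rnorm x' <= c * rnorm (L x).
Proof.
move=> bL pL; have [lL [b b0 Lb]] := bL.
apply: contrapT => nlift.
have bad n : exists x, forall x', L x' = L x -> n.+1%:R * rnorm (L x) < rnorm x'.
  apply: contrapT => H; apply: nlift; exists n.+1%:R; first by rewrite ltr0Sn.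
  move=> x; apply: contrapT => H'; apply: H; exists x => x' xx'.
  by rewrite ltNge; apply/negP => le; apply: H'; exists x'.
pose x n := sval (cid (bad n)).
have xP n x' : L x' = L (x n) -> n.+1%:R * rnorm (L (x n)) < rnorm x'.
  exact: (svalP (cid (bad n))).
have Lx0 n : 0 < rnorm (L (x n)).
  rewrite lt_neqAle rnorm_ge0 andbT eq_sym; apply/eqP => /rnorm_eq0 L0.
  have := @xP n 0; rewrite L0 lin0// => /(_ erefl).
  by rewrite rnorm0 mulr0 ltxx.
pose A n := [set rnorm x' | x' in [set x' | L x' = L (x n)]].
have iA n : has_inf (A n).
  split; first by exists (rnorm (x n)), (x n).
  by exists 0 => _ [x' _ <-]; exact: rnorm_ge0.
have d0 n : n.+1%:R * rnorm (L (x n)) <= inf (A n).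
  by apply: lb_le_inf => [|_ [x' /= xx' <-]]; [exact: (iA n).1|exact/ltW/xP].
have dpos n : 0 < inf (A n).
  by apply: lt_le_trans (d0 n); rewrite mulr_gt0 ?ltr0Sn.
have near_inf n : exists x', L x' = L (x n) /\ rnorm x' < 2 * inf (A n).
  have [_ [x' xx' <-] lt] := inf_adherent (dpos n) (iA n).
  by exists x'; split=> //; rewrite mulr2n mulrDl !mul1r.
pose z n := sval (cid (near_inf n)).
have [zL zle] : (forall n, L (z n) = L (x n)) /\
    (forall n, rnorm (z n) < 2 * inf (A n)).
  by split=> n; case: (svalP (cid (near_inf n))).
pose y n := ((inf (A n))^-1)%:C *: z n.
have ny n w : rnorm (((inf (A n))^-1)%:C *: w) = (inf (A n))^-1 * rnorm w.
  by rewrite rnormZ normc_real ger0_norm// invr_ge0 ltW.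
have yle n : rnorm (y n) <= 2.
  by rewrite ny mulrC ler_pdivrMr// ltW.
have Ly : ulim U (fun n => L (y n)) 0.
  apply: (@ulim_le _ _ UU _ _ _ (fun n => n.+1%:R^-1)); last exact: ultra_invn.
  move=> n; rewrite subr0 linZ// ny zL mulrC ler_pdivrMr//.
  by rewrite mulrC ler_pdivlMr ?ltr0Sn// mulrC.
have [w yw] := pL y _ _ yle Ly.
have Lw : L w = 0 := ulim_uniq UU (ulim_op bL yw) Ly.
have [n /= ynw] := ultra_ex UU (yw 1 ltr01).
pose dn := (inf (A n))%:C.
have dnE : dn *: y n = z n.
  rewrite /y scalerA -rmorphM mulfV ?gt_eqF//.
  by rewrite rmorph1 scale1r.
have An : A n (rnorm (z n - dn *: w)).
  by exists (z n - dn *: w) => //=; rewrite linB// linZ// Lw scaler0 subr0.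
have := ge_inf (iA n).2 An; apply/negP; rewrite -ltNge.
rewrite -dnE -scalerBr rnormZ normc_real ger0_norm ?ltW//.
by rewrite gtr_pMr.
Qed.

(** A convergent sequence in the range lifts to a sequence that is bounded and
    therefore convergent along the ultrafilter. *)
Lemma uclosed_range L : bounded_op L -> proper_op L -> uclosed (range L).
Proof.
move=> bL pL s y Ls sy; have [c c0 Lc] := proper_op_lift bL pL.
have /choice[z zL] n : exists z, L z = s n /\ rnorm z <= c * rnorm (s n).
  by have [x _ <-] := Ls n; have [x' ? ?] := Lc x; exists x'.
(* the sequence is bounded only eventually along the ultrafilter *)
pose good n := rnorm (s n) <= rnorm y + 1.
have Ug : U [set n | good n].
  have UF := ultra_filter UU; apply: filterS (sy 1 ltr01) => n /= sn.
  by rewrite /good -[s n](subrK y) addrC (le_trans (rnormD _ _))// lerD// ltW.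
pose z' n := if good n then z n else 0.
have z'c n : rnorm (z' n) <= c * (rnorm y + 1).
  rewrite /z'; case: ifPn => [gn|_]; last first.
    by rewrite rnorm0 mulr_ge0 ?addr_ge0 ?rnorm_ge0// ltW.
  by rewrite (le_trans (zL n).2)// ler_wpM2l// ltW.
have Lz' : ulim U (fun n => L (z' n)) y.
  apply: (ulim_near UU _ sy); have UF := ultra_filter UU.
  by apply: filterS Ug => n /= gn; rewrite /z' gn (zL n).1.
have [x z'x] := pL z' _ _ z'c Lz'.
exists x => //; exact: (ulim_uniq UU (ulim_op bL z'x) Lz').
Qed.

Lemma dist_closed_gt0 E x : uclosed E -> ~ E x ->
  exists2 d : R, 0 < d & forall e, E e -> d <= rnorm (x - e).
Proof.
move=> cE Ex; apply: contrapT => H; apply: Ex.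
have /choice[s sP] n : exists e, E e /\ rnorm (x - e) < n.+1%:R^-1.
  apply: contrapT => H'; apply: H; exists (n.+1%:R^-1).
    by rewrite invr_gt0 ltr0Sn.
  by move=> e Ee; rewrite leNgt; apply/negP => lt; apply: H'; exists e.
apply: (cE s) => [n|]; first exact: (sP n).1.
apply: (@ulim_le _ _ UU _ _ _ (fun n => n.+1%:R^-1)) => [n|].
  by rewrite rnormC ltW// (sP n).2.
exact: ultra_invn.
Qed.

(** F. Riesz's lemma: normalise the difference between a vector outside [E] and
    a point of [E] at less than twice the minimal distance. *)
Lemma riesz_lemma E F : subspace E -> uclosed E -> subspace F -> E `<=` F ->
  ~ F `<=` E ->
  exists2 u, F u & rnorm u = 1 /\ forall e, E e -> 1 / 2 <= rnorm (u - e).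
Proof.
move=> sE cE sF EF FE.
have [x Fx Ex] : exists2 x, F x & ~ E x.
  apply: contrapT => H; apply: FE => x Fx; apply: contrapT => Ex.
  by apply: H; exists x.
pose A := [set rnorm (x - e) | e in E].
have iA : has_inf A.
  split; first by exists (rnorm (x - 0)), 0 => //; exact: sE.1.
  by exists 0 => _ [x' _ <-]; exact: rnorm_ge0.
have dpos : 0 < inf A.
  have [d d0 dE] := dist_closed_gt0 cE Ex.
  by apply: lt_le_trans d0 _; apply: lb_le_inf iA.1 _ => _ [e Ee <-]; exact: dE.
have [_ [e Ee <-] lt] := inf_adherent dpos iA.
have xe0 : 0 < rnorm (x - e).
  by rewrite (lt_le_trans dpos)//; apply: ge_inf => //; [exact: iA.2|exists e].
exists (((rnorm (x - e))^-1)%:C *: (x - e)).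
  by apply: subspaceZ => //; apply: subspaceB => //; exact: EF.
have nE w : rnorm (((rnorm (x - e))^-1)%:C *: w) = (rnorm (x - e))^-1 * rnorm w.
  by rewrite rnormZ normc_real ger0_norm// invr_ge0 ltW.
split; first by rewrite nE mulVf// gt_eqF.
move=> f Ef.
have -> : f = ((rnorm (x - e))^-1)%:C *: ((rnorm (x - e))%:C *: f).
  by rewrite scalerA -rmorphM mulVf ?gt_eqF// rmorph1 scale1r.
rewrite -scalerBr nE ler_pdivlMl// -addrA -opprD.
apply: (@le_trans _ _ (inf A)); last first.
  apply: ge_inf; first exact: iA.2.
  by eexists; last reflexivity; apply: subspaceD => //; exact: subspaceZ.
by rewrite mulrA mulr1 ler_pdivrMr// mulrC mulr2n mulrDl !mul1r ltW.
Qed.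

(** A decreasing chain of closed subspaces that never becomes stationary
    carries a separated sequence of unit vectors. *)
Lemma riesz_chain (X : nat -> set V) : (forall n, subspace (X n)) ->
  (forall n, uclosed (X n)) -> (forall n m, (n <= m)%N -> X m `<=` X n) ->
  (forall n, exists2 m, (n <= m)%N & ~ X m `<=` X m.+1) ->
  exists (u : nat -> V) (f : nat -> nat),
    forall n, [/\ (n <= f n)%N, X (f n) (u n), rnorm (u n) = 1 &
      forall e, X (f n).+1 e -> 1 / 2 <= rnorm (u n - e)].
Proof.
move=> sX cX dX strict.
have H n : exists p : V * nat, [/\ (n <= p.2)%N, X p.2 p.1, rnorm p.1 = 1 &
    forall e, X p.2.+1 e -> 1 / 2 <= rnorm (p.1 - e)].
  have [m nm Xm] := strict n.
  have [u Xu [u1 uX]] := riesz_lemma (sX m.+1) (cX m.+1) (sX m)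
    (dX _ _ (leqnSn m)) Xm.
  by exists (u, m).
have [p pP] := choice H.
by exists (fun n => (p n).1), (fun n => (p n).2) => n; exact: pP.
Qed.

(** Stationarity of decreasing chains of closed subspaces in the kernel stands
    in for counting dimensions there. *)
Lemma proper_op_chain_stationary L (X : nat -> set V) : linear L ->
  proper_op L -> (forall n, subspace (X n)) -> (forall n, uclosed (X n)) ->
  (forall n m, (n <= m)%N -> X m `<=` X n) ->
  (forall n, X n `<=` [set x | L x = 0]) ->
  exists n, forall m, (n <= m)%N -> X n `<=` X m.
Proof.
move=> lL pL sX cX dX XL; apply: contrapT => nstat.
have [n|u [f uf]] := riesz_chain sX cX dX.
  apply: contrapT => H; apply: nstat; exists n => m.
  elim: m => [|m ih]; first by rewrite leqn0 => /eqP ->.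
  rewrite leq_eqVlt => /orP[/eqP ->//|]; rewrite ltnS => nm.
  apply: subset_trans (ih nm) _; apply: contrapT => Hm; apply: H.
  by exists m.
have u1 n : rnorm (u n) <= 1 by case: (uf n) => _ _ -> _.
have Lu : ulim U (fun n => L (u n)) 0.
  move=> e e0; apply: (@filterE _ _ (ultra_filter UU)) => n /=.
  by case: (uf n) => _ /XL /= -> _ _; rewrite subrr rnorm0.
have [x ux] := pL u _ _ u1 Lu.
have e0 : (0 : R) < 1 / 2 by lra.
have [n [m [nm]]] := ulim_cauchy UU Uoo (fun n => (f n).+1) ux e0.
apply/negP; rewrite -leNgt rnormC.
have [fm Xm _ _] := uf m; case: (uf n) => _ _ _; apply.
exact: (dX _ _ (leq_trans nm fm)).
Qed.

End properness.

(** * Finite-dimensional kernels and compact perturbations of the identity *)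

Section compactness.
Context (R : realType) (U : set_system nat).
Hypothesis UU : UltraFilter U.
Hypothesis Uoo : \oo `<=` U.
Context (V : normedModType R[i]).
Implicit Types (L C : V -> V) (s : nat -> V) (x y : V) (E F : set V) (t : seq V).

Fixpoint span_seq t : set V :=
  if t is x :: t' then [set y | exists a, span_seq t' (y - a *: x)] else [set 0].

Lemma subspace_span_seq t : subspace (span_seq t).
Proof.
elim: t => [|x t ih] /=.
  by split=> // a _ _ /= -> ->; rewrite scaler0 addr0.
split=> [|a y z [b yb] [c zc]].
  by exists 0; rewrite scale0r subrr; exact: ih.1.
exists (a * b + c); rewrite scalerDl -scalerA opprD addrACA -scalerBr.
exact: ih.2.
Qed.

Lemma span_seq_cons x t : span_seq t `<=` span_seq (x :: t).
Proof. by move=> y ty; exists 0; rewrite scale0r subr0. Qed.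

Lemma span_seq_head x t : span_seq (x :: t) x.
Proof. by exists 1; rewrite scale1r subrr; exact: (subspace_span_seq t).1. Qed.

Lemma span_seq_sub E x t : subspace E -> E x -> span_seq t `<=` E ->
  span_seq (x :: t) `<=` E.
Proof.
move=> sE Ex tE y [a /tE Eya]; rewrite -[y](subrK (a *: x)).
by apply: subspaceD => //; exact: subspaceZ.
Qed.

Lemma span_seq_finite t : finite_dimensional (span_seq t).
Proof.
exists (size t), (fun i => t`_i); elim: t => [|x t ih] y /=.
  by move=> ->; exists (fun=> 0); rewrite big_ord0.
move=> [a /ih[c yc]].
exists (fun i => if unlift ord0 i is Some j then c j else a).
rewrite big_ord_recl unlift_none /= -[LHS](subrK (a *: x)) addrC yc.
by congr (_ + _); apply: eq_bigr => i _; rewrite liftK.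
Qed.

(** Adding a vector at positive distance from a closed subspace keeps it
    closed: the coefficients of that vector stay bounded, so they converge
    along the ultrafilter. *)
Lemma uclosed_span_seq t : uclosed U (span_seq t).
Proof.
have UF := ultra_filter UU.
elim: t => [|x t ih] /=.
  move=> s y s0 sy; apply: (ulim_uniq UU sy) => e e0.
  by apply: filterE => n; rewrite /= (s0 n) subrr rnorm0.
have sE := subspace_span_seq t; set E := span_seq t in ih sE *.
have [Ex|Ex] := pselect (E x).
  move=> s y sxy sy; apply: span_seq_cons; apply: (ih s) => // n.
  by apply: (span_seq_sub sE Ex) (sxy n) => z.
have [d d0 dE] := dist_closed_gt0 UU Uoo ih Ex.
move=> s y /choice[a aE] sy.
have aB n : normc (a n) * d <= rnorm (s n).
  have [->|an0] := eqVneq (a n) 0; first by rewrite normc0 mul0r rnorm_ge0.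
  have Ee : E (- ((a n)^-1 *: (s n - a n *: x))).
    by apply: subspaceN => //; exact: (subspaceZ _ sE (aE n)).
  have -> : s n = a n *: (x - - ((a n)^-1 *: (s n - a n *: x))).
    by rewrite opprK scalerDr scalerA mulfV// scale1r addrC subrK.
  by rewrite rnormZ ler_wpM2l ?normc_ge0// dE.
pose good n := rnorm (s n) <= rnorm y + 1.
have Ug : U [set n | good n].
  apply: filterS (sy 1 ltr01) => n /= sn.
  by rewrite /good -[s n](subrK y) addrC (le_trans (rnormD _ _))// lerD// ltW.
pose a' n : R[i]^o := if good n then a n else 0.
have a'B n : normc (a' n) <= (rnorm y + 1) / d.
  rewrite /a'; case: ifPn => [gn|_]; last first.
    by rewrite normc0 divr_ge0 ?addr_ge0 ?rnorm_ge0// ltW.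
  by rewrite ler_pdivlMr// (le_trans (aB n)).
have [b a'b] := complex_bounded_ulim UU a'B.
exists b; apply: (ih (fun n => if good n then s n - a n *: x else 0)).
  by move=> n; case: ifP => _; [exact: aE|exact: sE.1].
apply: (@ulim_near _ _ UU _ (fun n => s n - a' n *: x)).
  by apply: filterS Ug => n /= gn; rewrite /a' gn.
apply: ulimB => //.
move=> e e0; have e1 : 0 < e / (rnorm x + 1).
  by rewrite divr_gt0// ltr_wpDl// rnorm_ge0.
apply: filterS (a'b _ e1) => n /=; rewrite rnorm_complex => an.
rewrite -scalerBl rnormZ (@le_lt_trans _ _ (normc (a' n - b) * (rnorm x + 1)))//.
  by rewrite ler_wpM2l ?normc_ge0// lerDl.
by rewrite -ltr_pdivlMr// ltr_wpDl// rnorm_ge0.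
Qed.

(** An infinite-dimensional kernel would contain, by Riesz's lemma, a separated
    sequence of unit vectors, on which the operator vanishes. *)
Lemma proper_op_ker_finite L : bounded_op L -> proper_op U L ->
  finite_dimensional [set x | L x = 0].
Proof.
move=> bL pL; apply: contrapT => nfin.
pose N := [set x | L x = 0].
have sN : subspace N by apply: subspace_ker; case: bL.
have /choice[g gP] t : exists u, span_seq t `<=` N -> [/\ N u, rnorm u = 1 &
    forall e, span_seq t e -> 1 / 2 <= rnorm (u - e)].
  have [tN|tN] := pselect (span_seq t `<=` N); last by exists 0.
  have [|u Nu [u1 uE]] := riesz_lemma UU Uoo (subspace_span_seq t)
    (@uclosed_span_seq t) sN tN; last by exists u.
  move=> Nt; apply: nfin; have [n [e et]] := span_seq_finite t.
  by exists n, e => u /Nt/et.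
pose S n := iter n (fun t => g t :: t) [::].
have SN n : span_seq (S n) `<=` N.
  elim: n => [|n ih] /=; first by move=> _ ->; exact: sN.1.
  by apply: span_seq_sub => //; have [] := gP _ ih.
have SS n m : (n <= m)%N -> span_seq (S n) `<=` span_seq (S m).
  elim: m => [|m ih]; first by rewrite leqn0 => /eqP ->.
  rewrite leq_eqVlt => /orP[/eqP -> //|]; rewrite ltnS => /ih nm.
  by apply: subset_trans nm _; exact: span_seq_cons.
pose u n := g (S n).
have u1 n : rnorm (u n) <= 1 by rewrite /u; have [_ -> _] := gP _ (SN n).
have Lu : ulim U (fun n => L (u n)) 0.
  move=> e e0; apply: (@filterE _ _ (ultra_filter UU)) => n /=.
  by rewrite /u; have [-> _ _] := gP _ (SN n); rewrite subrr rnorm0.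
have [x ux] := pL u _ _ u1 Lu.
have e0 : (0 : R) < 1 / 2 by lra.
have [n [m [nm]]] := ulim_cauchy UU Uoo succn ux e0.
apply/negP; rewrite -leNgt; have [_ _] := gP _ (SN m); apply.
by apply: (SS n.+1) => //; exact: span_seq_head.
Qed.

Definition compact_ulim_op C : Prop := forall s (c : R),
  (forall n, rnorm (s n) <= c) -> exists y, ulim U (fun n => C (s n)) y.

Lemma compact_perturbation_proper C : compact_ulim_op C ->
  proper_op U (fun x => x - C x).
Proof.
move=> cC s c y sc sy; have [z sz] := cC s c sc; exists (y + z).
apply: (ulim_near UU _ (ulimD UU sy sz)).
by apply: (@filterE _ _ (ultra_filter UU)) => n /=; rewrite subrK.
Qed.

(** Riesz: if an injective [1 - C] were not onto, its iterated ranges would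
    decrease strictly, and a separated sequence chosen along them would be
    mapped by [C] to a separated sequence. *)
Lemma compact_perturbation_surj C : bounded_op C -> compact_ulim_op C ->
  (forall x, x - C x = 0 -> x = 0) -> forall y, exists x, x - C x = y.
Proof.
move=> bC cC iC y; apply: contrapT => ny.
pose L x := x - C x.
have bL : bounded_op L := bounded_opB (bounded_op_id V) bC.
have pL : proper_op U L := compact_perturbation_proper cC.
have lLk k : linear (iter k L) by case: (bounded_op_iter k bL).
have injk k x z : iter k L x = iter k L z -> x = z.
  move=> xz; apply/subr0_eq; have : iter k L (x - z) = 0.
    by rewrite linB// xz subrr.
  by elim: k {xz} => //= k ih /iC.
pose X n := range (iter n L).
have dX n m : (n <= m)%N -> X m `<=` X n.
  move=> nm _ [x _ <-]; exists (iter (m - n) L x) => //.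
  by rewrite -iterD subnKC.
have XL n x : X n x -> X n.+1 (L x) by move=> [w _ <-]; exists w.
have [n|n|n|u [f uf]] := riesz_chain UU Uoo _ _ dX.
- by apply: subspace_range; exact: lLk.
- by apply: (uclosed_range UU Uoo); [exact: bounded_op_iter|exact: proper_op_iter].
- exists n => // /(_ (iter n L y))[|x _]; first by exists y.
  by rewrite iterSr => /injk xy; apply: ny; exists x.
have u1 n : rnorm (u n) <= 1 by case: (uf n) => _ _ -> _.
have [x ux] := cC u _ u1.
have e0 : (0 : R) < 1 / 2 by lra.
have [n [m [nm]]] := ulim_cauchy UU Uoo (fun n => (f n).+1) ux e0.
apply/negP; rewrite -leNgt rnormC.
have [fm Xm _ _] := uf m; have [_ Xn _ un] := uf n.
have -> : C (u n) - C (u m) = u n - (L (u n) + (u m - L (u m))).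
  by rewrite /L subKr opprD addrA subKr.
have sX : subspace (X (f n).+1) by apply: subspace_range; exact: lLk.
have fnm : ((f n).+1 <= f m)%N := leq_trans nm fm.
apply: un; apply: (subspaceD sX (XL _ _ Xn)).
apply: (subspaceB sX (dX _ _ fnm _ Xm)).
by apply: (dX _ _ _ _ (XL _ _ Xm)); exact: leqW.
Qed.

End compactness.

(** * Eigenvalues near a point where the pencil is proper *)

Section fredholm_pencil.
Context (R : realType) (U : set_system nat).
Hypothesis UU : UltraFilter U.
Hypothesis Uoo : \oo `<=` U.
Context (V : normedModType R[i]).
Variable A : V -> V.
Hypothesis bA : bounded_op A.
Implicit Types (z w : R[i]) (u v x y : V).

Definition pencil z u := A u - z *: u.

Lemma bounded_pencil z : bounded_op (pencil z).
Proof.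
apply: bounded_opB bA _.
by apply: (bounded_opZ z (bounded_op_id V)).
Qed.

Lemma linear_pencil z : linear (pencil z).
Proof. by case: (bounded_pencil z). Qed.

(** The obstruction to isolation: a nonzero kernel vector in the range of each
    power, or equivalently an infinite ascent. *)
Definition kernel_meets_ranges z : Prop := forall k : nat, exists u v,
  [/\ u != 0, pencil z u = 0 & iter k (pencil z) v = u].

Definition eigenvalue_limit z : Prop := forall e : R, 0 < e ->
  exists w, [/\ w != z, normc (w - z) < e & eigenvalue_op A w].

(** An eigenvector with eigenvalue [w != z] lies in the range of every power of
    the pencil at [z]. Unit eigenvectors for eigenvalues tending to [z] converge
    along the ultrafilter, and their limit is a kernel vector that stays in
    these closed ranges. *)
Lemma eigenvalue_limit_kernel_meets_ranges z : proper_op U (pencil z) ->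
  eigenvalue_limit z -> kernel_meets_ranges z.
Proof.
move=> pz lz k; have UF := ultra_filter UU.
have /choice[f fP] n : exists p : V * R[i], [/\ p.2 != z,
    normc (p.2 - z) < n.+1%:R^-1, rnorm p.1 = 1 & A p.1 = p.2 *: p.1].
  have n0 : (0 : R) < n.+1%:R^-1 by rewrite invr_gt0 ltr0Sn.
  have [w [wz wn [u u0 Au]]] := lz _ n0.
  exists (((rnorm u)^-1)%:C *: u, w); split=> //=.
    rewrite rnormZ normc_real ger0_norm ?invr_ge0 ?rnorm_ge0//.
    by rewrite mulVf// gt_eqF// rnorm_gt0.
  by rewrite (linZ _ _ bA.1) Au !scalerA mulrC.
pose s n := (f n).1.
have Ls n : pencil z (s n) = ((f n).2 - z) *: s n.
  by rewrite /pencil /s; have [_ _ _ ->] := fP n; rewrite -scalerBl.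
have s1 n : rnorm (s n) <= 1 by rewrite /s; have [_ _ -> _] := fP n.
have Ls0 : ulim U (fun n => pencil z (s n)) 0.
  apply: (@ulim_le _ _ UU _ _ _ (fun n => n.+1%:R^-1)); last exact: ultra_invn.
  move=> n; rewrite subr0 Ls rnormZ /s; have [_ /ltW lt -> _] := fP n.
  by rewrite mulr1.
have [x sx] := pz s _ _ s1 Ls0.
have x1 : 1 <= rnorm x.
  by apply: (ulim_norm_ge UU sx); apply: filterE => n /=; rewrite /s; have [_ _ -> _] := fP n.
have [v _ vx] : range (iter k (pencil z)) x.
  have bk := bounded_op_iter k (bounded_pencil z).
  apply: (uclosed_range UU Uoo bk _ _ sx).
    exact: proper_op_iter (bounded_pencil z) pz.
  move=> n; exists (((f n).2 - z) ^- k *: s n) => //; rewrite (linZ _ _ bk.1).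
  have fz : (f n).2 - z != 0 by rewrite subr_eq0; have [] := fP n.
  have -> : iter k (pencil z) (s n) = ((f n).2 - z) ^+ k *: s n.
    elim: k {bk} => [|k ih] /=; first by rewrite expr0 scale1r.
    by rewrite ih (linZ _ _ (linear_pencil z)) Ls scalerA exprSr.
  by rewrite scalerA mulVf ?expf_neq0// scale1r.
exists x, v; split=> //; last exact: (ulim_uniq UU (ulim_op UU (bounded_pencil z) sx)).
by apply/eqP => x0; move: x1; rewrite x0 rnorm0 ler10.
Qed.

(** The tail of the chain of ranges of the powers is mapped onto itself with a
    bound, so a kernel vector in it starts a chain [u, v1, v2, ...] of
    successive preimages of at most geometric growth; the sum of
    [zeta ^ k *: v_k] is an eigenvector for [z + zeta]. The partial sums are
    approximate eigenvectors close to [u], and properness replaces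
    completeness. *)
Lemma kernel_meets_ranges_open z : proper_op U (pencil z) ->
  kernel_meets_ranges z -> exists2 e : R, 0 < e & forall w,
    normc (w - z) < e -> proper_op U (pencil w) -> eigenvalue_op A w.
Proof.
move=> pz hz; set L := pencil z in pz *.
have bL : bounded_op L := bounded_pencil z.
have lL : linear L := linear_pencil z.
have bLk k := bounded_op_iter k bL.
have lLk k : linear (iter k L) := (bLk k).1.
have dran n m : (n <= m)%N -> range (iter m L) `<=` range (iter n L).
  move=> nm _ [x _ <-]; exists (iter (m - n) L x) => //.
  by rewrite -iterD subnKC.
pose X n := [set x | L x = 0] `&` range (iter n L).
(* from the index [n] on, the kernel vectors in the range of the [n]-th power
   lie in all ranges *)
have [n|n|n m nm|n x []//|n Xn] := @proper_op_chain_stationary _ U UU Uoo _ L X lL pz.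
- by apply: subspaceI; [exact: subspace_ker|exact: subspace_range].
- apply: uclosedI; first exact: uclosed_ker.
  by apply: (uclosed_range UU Uoo (bLk n)); exact: proper_op_iter.
- by apply: setIS; exact: dran.
pose M x := forall k, range (iter k L) x.
have XM x : X n x -> M x.
  move=> Xx k; have [kn|/ltnW nk] := leqP k n; first exact: dran kn _ Xx.2.
  exact: (Xn _ nk _ Xx).2.
have [b b0 Lb] := (bLk n).2.
have [c c0 Lc] := proper_op_lift UU Uoo (bLk n.+1) (proper_op_iter (k := n.+1) bL pz).
have /choice[g gP] v : exists v', M v ->
    [/\ L v' = v, M v' & rnorm v' <= (b * c + 1) * rnorm v].
  have [Mv|nMv] := pselect (M v); last by exists 0.
  have [y _ yv] := Mv n.+1.
  have [y' y'v y'le] := Lc y.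
  exists (iter n L y') => _; split; first by rewrite -iterS y'v yv.
    move=> k; have [kn|/ltnW nk] := leqP k n; first by apply: (dran _ _ kn); exists y'.
    have [q _ qv] := Mv k.+1.
    rewrite -[iter n L y'](subrK (iter k L q)).
    apply: subspaceD; [exact: subspace_range| |by exists q].
    have rk : range (iter n L) (iter k L q) by apply: (dran _ _ nk); exists q.
    apply: (Xn _ nk _ _).2; split; last first.
      by apply: subspaceB rk; [exact: subspace_range|exists y'].
    by rewrite /= linB// -!iterS y'v yv qv subrr.
  rewrite (le_trans (Lb _))// -yv mulrDl mul1r -mulrA.
  by rewrite ler_wpDr ?rnorm_ge0// ler_wpM2l.
have [u [w [u0 Lu wu]]] := hz n.
have Mu : M u by apply: XM; split => //; exists w.
pose C := b * c + 1; have C0 : 0 < C by rewrite ltr_wpDl// mulr_ge0// ltW.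
pose v k := iter k g u.
have Mv k : M (v k) by elim: k => //= k ih; have [] := gP _ ih.
have Lv k : L (v k.+1) = v k by have [] := gP _ (Mv k).
have vle k : rnorm (v k) <= C ^+ k * rnorm u.
  elim: k => [|k ih]; first by rewrite expr0 mul1r.
  have [_ _ le] := gP _ (Mv k).
  by rewrite (le_trans le)// exprS -mulrA ler_wpM2l// ltW.
have n3 : (0 : R) < 3^-1 by rewrite invr_gt0.
(* with this radius the terms of the series are dominated by [3^-1 ^+ k], so the
   terms after the first add up to at most half of the norm of [u] *)
exists (3^-1 / C) => [|z' zz' pz']; first by rewrite divr_gt0.
set t := z' - z in zz' *.
have term k : rnorm (t ^+ k *: v k) <= 3^-1 ^+ k * rnorm u.
  rewrite rnormZ; have -> : normc (t ^+ k) = normc t ^+ k.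
    by elim: k => [|k ih]; rewrite ?normc1// !exprS normcM ih.
  rewrite (@le_trans _ _ (normc t ^+ k * (C ^+ k * rnorm u)))//.
    by rewrite ler_wpM2l// exprn_ge0// normc_ge0.
  rewrite mulrA -exprMn ler_wpM2r ?rnorm_ge0// lerXn2r ?nnegrE//.
  - by rewrite mulr_ge0 ?normc_ge0// ltW.
  - by rewrite -ler_pdivlMr// ltW.
pose s m := \sum_(k < m.+1) t ^+ k *: v k.
have sS m : s m.+1 = s m + t ^+ m.+1 *: v m.+1 by rewrite /s big_ord_recr.
have su m : rnorm (s m - u) <= 1 / 2 * (1 - 3^-1 ^+ m) * rnorm u.
  elim: m => [|m ih].
    by rewrite /s big_ord1 expr0 scale1r subrr rnorm0 subrr mulr0 mul0r.
  rewrite sS addrAC (le_trans (rnormD _ _))//.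
  rewrite (le_trans (lerD ih (term m.+1)))// exprS.
  by rewrite -mulrDl ler_wpM2r ?rnorm_ge0//; lra.
have Ls m : pencil z' (s m) = - (t ^+ m.+1 *: v m).
  have Lz' x : pencil z' x = L x - t *: x.
    by rewrite /L /pencil /t scalerBl opprB addrA subrK.
  elim: m => [|m ih].
    by rewrite Lz' /s big_ord1 expr0 scale1r /v /= (Lu : L u = 0) sub0r expr1.
  rewrite sS (linD _ _ (linear_pencil z')) ih Lz' (linZ _ _ lL) Lv scalerA -exprS.
  by rewrite addKr.
have p3 m : 3^-1 ^+ m <= m.+1%:R^-1 :> R.
  rewrite exprVn lef_pV2 ?posrE ?exprn_gt0 ?ltr0Sn//.
  by rewrite -natrX ler_nat; exact: ltn_expl.
have su2 m : rnorm (s m - u) <= 1 / 2 * rnorm u.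
  apply: (le_trans (su m)); rewrite ler_wpM2r ?rnorm_ge0//.
  have : 0 <= 3^-1 ^+ m :> R by rewrite exprn_ge0// ltW.
  by lra.
have Ls0 : ulim U (fun m => pencil z' (s m)) 0.
  have K0 : 0 < normc t * rnorm u + 1.
    by rewrite ltr_wpDl// mulr_ge0 ?normc_ge0 ?rnorm_ge0.
  apply: (@ulim_le _ _ UU _ _ _ (fun m => (normc t * rnorm u + 1) * m.+1%:R^-1)).
    move=> m; rewrite subr0 Ls rnormN exprS -scalerA rnormZ.
    rewrite mulrDl mul1r ler_wpDr ?invr_ge0 ?ler0n// -mulrA.
    rewrite ler_wpM2l ?normc_ge0// (le_trans (term m))// mulrC.
    by rewrite ler_wpM2l ?rnorm_ge0.
  move=> e e0; have UF := ultra_filter UU.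
  apply: filterS (ultra_invn Uoo (divr_gt0 e0 K0)) => m /=.
  by rewrite ltr_pdivlMr// mulrC.
have sB m : rnorm (s m) <= 1 / 2 * rnorm u + rnorm u.
  by rewrite -[s m](subrK u) (le_trans (rnormD _ _))// lerD2r.
have [x sx] := pz' s _ _ sB Ls0.
exists x; last first.
  by apply/subr0_eq/(ulim_uniq UU (ulim_op UU (bounded_pencil z') sx)).
apply/eqP => x0; have := ulim_norm_le UU (ulimB UU sx (ulim_cst UU u)) su2.
rewrite x0 sub0r rnormN; have := rnorm_gt0 u0; lra.
Qed.

End fredholm_pencil.

(** * Continuity, boundedness and compactness of linear maps *)

Section linear_operators.
Context (R : realType) (V : normedModType R[i]).
Implicit Types (z w : R[i]).

Lemma infinite_injection (T : Type) (A : set T) : infinite_set A ->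
  exists2 f : nat -> T, injective f & forall n, A (f n).
Proof.
elim/Ppointed: T => T in A *.
  by move=> iA; exfalso; apply: iA; rewrite (_ : A = set0)// emptyE.
move=> /infiniteP/pcard_leP[f]; exists f => [m n fmn|n].
  by apply: (@inj _ _ _ f) fmn; rewrite inE.
exact: (@funS _ _ _ _ f).
Qed.

Lemma continuous_bounded_op (f : {linear V -> V}) : continuous f -> bounded_op f.
Proof.
move=> cf; split; first exact: linearP.
have /linear_boundedP/pinfty_ex_gt0[c c0 fc] := (linear_bounded_continuous f).2 cf.
have cE : c = (complex.Re c)%:C.
  by move: c0; case: c {fc} => a b; rewrite ltcE /= => /andP[/eqP -> _].
exists (complex.Re c) => [|x].
  by rewrite ltW// -ltcR -cE.
by have := fc x; rewrite !rnormE cE -rmorphM lecR.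
Qed.

Lemma bounded_op_continuous (L : V -> V) : bounded_op L ->
  exists2 f : {linear V -> V}, continuous f & forall x, f x = L x.
Proof.
move=> [lL [c c0 Lc]].
pose f : {linear V -> V} := HB.pack L (GRing.isLinear.Build _ _ _ _ L lL).
exists f => //; apply: bounded_linear_continuous; apply/linear_boundedP.
near=> r => x; apply: (@le_trans _ _ (c%:C * `|x|)).
  by rewrite !rnormE -rmorphM lecR.
by rewrite ler_wpM2r//; near: r; apply: nbhs_pinfty_ge; apply/complex_realP; exists c.
Unshelve. all: by end_near. Qed.

Lemma compact_operator_ulim U (f : V -> V) : UltraFilter U ->
  compact_operator f -> compact_ulim_op U f.
Proof.
move=> UU cf s c sc.
have B : bounded_set [set x : V | rnorm x <= c].
  exists c%:C; split; first by apply/complex_realP; exists c.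
  by move=> M cM x /= xc; rewrite (le_trans _ (ltW cM))// rnormE lecR.
have := cf _ B; rewrite precompactE => cK.
have [n|y _ sy] := compact_ulim UU cK (s := fun n => f (s n)); last by exists y.
by apply: subset_closure; exists (s n) => //=.
Qed.

End linear_operators.

(** * The spectrum of a compact operator minus a multiplication *)

Section complex_plane.
Context (R : realType).
Implicit Types (z w : R[i]) (t : R).

Lemma normcBC z w : normc (z - w) = normc (w - z).
Proof. by rewrite -!rnorm_complex rnormC. Qed.

Lemma normc_trg a z w : normc (z - w) <= normc (z - a) + normc (a - w).
Proof. by rewrite -!rnorm_complex rnorm_trg. Qed.

(** The vertical ray from [z] that points away from the real axis. *)
Definition ray z t : R[i] :=
  z + (0 +i* (t * (if 0 <= complex.Im z then 1 else -1)))%C.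

Lemma ray0 z : ray z 0 = z.
Proof. by rewrite /ray mul0r addr0. Qed.

Lemma ray_dist z t t' : normc (ray z t - ray z t') = `|t - t'|.
Proof.
rewrite /ray; set s := if _ then _ else _.
have s1 : `|s| = 1 by rewrite /s; case: ifP => _; rewrite ?normrN normr1.
rewrite (_ : _ - _ = (0 +i* ((t - t') * s))%C); last first.
  rewrite opprD addrACA subrr add0r; apply/eqP; rewrite eq_complex /=.
  by rewrite subrr mulrBl !eqxx.
by rewrite Defs.normcE /= expr0n /= add0r sqrtr_sqr normrM s1 mulr1.
Qed.

Lemma ray_neq z t t' : t != t' -> ray z t != ray z t'.
Proof.
rewrite -subr_eq0 -normr_gt0 -(ray_dist z) => pos; apply/eqP => eq.
by move: pos; rewrite eq subrr normc0 ltxx.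
Qed.

Lemma ray_nonreal z t r : 0 < t -> ray z t <> r%:C.
Proof.
move=> t0 zr; have : complex.Im (ray z t) = 0 by rewrite zr.
rewrite /ray; case: z {zr} => a b /= /eqP.
case: ifPn => [b0|]; first by rewrite gt_eqF// mulr1 ltr_wpDl.
by rewrite -ltNge => b0; rewrite mulrN1 lt_eqF// subr_lt0 (lt_trans b0).
Qed.

End complex_plane.

Section compact_minus_multiplication.
Context (R : realType) (U : set_system nat).
Hypothesis UU : UltraFilter U.
Hypothesis Uoo : \oo `<=` U.
Context (V : normedModType R[i]).
Variables (K H : V -> V) (Rh : set R).
Hypotheses (bK : bounded_op K) (cK : compact_ulim_op U K) (bH : bounded_op H).
Implicit Types (z w : R[i]) (u v x y : V).

Let A u := K u - H u.
Let Rc : set R[i] := [set r%:C | r in Rh].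

Let bA : bounded_op A. Proof. exact: bounded_opB. Qed.

Definition shift_invertible z : Prop := exists Q : V -> V,
  [/\ bounded_op Q, forall u, Q (H u + z *: u) = u &
      forall u, H (Q u) + z *: Q u = u].

Lemma pencil_shift z u : pencil A z u = K u - (H u + z *: u).
Proof. by rewrite /pencil /A opprD addrA. Qed.

Lemma shift_invertible_proper z : shift_invertible z -> proper_op U (pencil A z).
Proof.
move=> [Q [bQ QH _]] s c y sc sy; have [x sx] := cK sc.
exists (Q (x - y)).
apply: (ulim_near UU _ (ulim_op UU bQ (ulimB UU sx sy))).
apply: (@filterE _ _ (ultra_filter UU)) => n /=.
by rewrite pencil_shift subKr QH.
Qed.

(** [K - H - z] is [K Q - 1] composed with the invertible [H + z], so the
    Fredholm alternative for the compact [K Q] applies. *)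
Lemma shift_invertible_resolvent z : shift_invertible z ->
  ~ eigenvalue_op A z -> resolvent_set A z.
Proof.
move=> gz nz; have pz := shift_invertible_proper gz.
have [Q [bQ QH HQ]] := gz.
have bT := bounded_pencil bA z; have lT := bT.1.
have kerT u : pencil A z u = 0 -> u = 0.
  move=> /subr0_eq Au; apply/eqP; case: eqP => // /eqP u0.
  by exfalso; apply: nz; exists u.
have cKQ : compact_ulim_op U (fun u => K (Q u)).
  move=> s c sc; have [_ [d d0 Qd]] := bQ.
  apply: (cK (c := d * c)) => n; rewrite (le_trans (Qd _))//.
  by rewrite ler_wpM2l.
have surjT y : exists x, pencil A z x = y.
  have [|v vy] := compact_perturbation_surj UU Uoo (bounded_op_comp bK bQ) cKQ _ (- y).
    move=> v; rewrite -{1}[v]HQ => v0.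
    have Qv : Q v = 0 by apply: kerT; rewrite pencil_shift -opprB v0 oppr0.
    by rewrite -[v]HQ Qv (lin0 bH.1) scaler0 addr0.
  by exists (Q v); rewrite pencil_shift HQ -opprB vy opprK.
have /choice[S TS] := surjT.
have ST u : S (pencil A z u) = u.
  by apply/subr0_eq/kerT; rewrite linB// TS subrr.
have bS : bounded_op S.
  split=> [a x y|].
    by apply/subr0_eq/kerT; rewrite linB// lT !TS subrr.
  have [c c0 Tc] := proper_op_lift UU Uoo bT pz.
  exists c => [|y]; first exact: ltW.
  have [x' x'y] := Tc (S y); rewrite TS.
  by rewrite -[x']ST x'y TS.
have [f cf fS] := bounded_op_continuous bS.
exists f; split=> // u; first by rewrite fS; exact: ST.
by rewrite fS; exact: TS.
Qed.

Lemma eigenvalue_bounded : exists2 c : R, 0 <= c &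
  forall z, eigenvalue_op A z -> normc z <= c.
Proof.
have [_ [c c0 Ac]] := bA; exists c => // z [u u0 Au].
by rewrite -(@ler_pM2r _ (rnorm u)) ?rnorm_gt0// -rnormZ -Au.
Qed.

Hypothesis inv : forall z, ~ Rc z -> shift_invertible z.

Let eigenvalues_near z := exists2 e : R, 0 < e &
  forall w, normc (w - z) < e -> ~ Rc w -> eigenvalue_op A w.

(** The pencil is Fredholm of index zero off the range. If eigenvalues
    accumulated at [z], they would fill a neighbourhood of [z], then of each
    point of a vertical ray from [z] that leaves the real axis; but the
    eigenvalues are bounded. *)
Lemma eigenvalues_isolated z : ~ Rc z -> ~ eigenvalue_limit A z.
Proof.
have limit_near w : ~ Rc w -> eigenvalue_limit A w -> eigenvalues_near w.
  move=> /[dup] Rw /inv/shift_invertible_proper pw lw.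
  have [e e0 eP] := kernel_meets_ranges_open UU Uoo bA pw
    (eigenvalue_limit_kernel_meets_ranges UU Uoo bA pw lw).
  by exists e => // w' /eP + /inv/shift_invertible_proper.
move=> Rz lz.
have pR t : 0 <= t -> ~ Rc (ray z t).
  rewrite le_eqVlt => /orP[/eqP <-|t0 [r _ /esym]]; first by rewrite ray0.
  exact: ray_nonreal.
have [c c0 eigc] := eigenvalue_bounded.
pose S := [set t | 0 <= t /\ eigenvalues_near (ray z t)].
have S0 : S 0 by split=> //; rewrite ray0; exact: limit_near.
have eigS t : S t -> eigenvalue_op A (ray z t).
  move=> [t0 [e e0 eP]]; apply: eP; last exact: pR.
  by rewrite subrr normc0.
have hS : has_sup S.
  split; first by exists 0.
  exists (c + normc z) => t St; have /eigc pc := eigS _ St.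
  have := ray_dist z t 0; rewrite subr0 ger0_norm ?St.1// => <-.
  rewrite ray0 -!rnorm_complex (le_trans (rnormB _ _))// lerD2r.
  by rewrite rnorm_complex.
have T0 : 0 <= sup S by apply: ub_le_sup => //; exact: hS.2.
have [e e0 eP] : eigenvalues_near (ray z (sup S)).
  apply: limit_near; first exact: pR.
  move=> e e0; have [t St tlt] := sup_adherent e0 hS.
  have tle : t <= sup S by apply: ub_le_sup => //; exact: hS.2.
  have [tS|tS] := eqVneq t (sup S); last first.
    exists (ray z t); split; [exact: ray_neq|rewrite ray_dist|exact: eigS].
    by rewrite distrC ger0_norm ?subr_ge0// ltrBlDr addrC -ltrBlDr.
  have [t0 [e1 e10 e1P]] := St; pose m := Num.min e e1 / 2.
  have mpos : 0 < Num.min e e1 by rewrite lt_min e0.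
  have m0 : 0 < m by rewrite divr_gt0.
  have mlt : m < Num.min e e1 by rewrite ltr_pdivrMr// mulr2n mulrDr mulr1 ltrDl.
  have pBm : normc (ray z (t + m) - ray z t) = m.
    by rewrite ray_dist addrAC subrr add0r gtr0_norm.
  exists (ray z (t + m)); rewrite -tS; split.
  - by apply: ray_neq; rewrite -subr_eq0 addrAC subrr add0r gt_eqF.
  - by rewrite pBm (lt_le_trans mlt)// ge_min lexx.
  - apply: e1P; last by apply: pR; rewrite addr_ge0// ltW.
    by rewrite pBm (lt_le_trans mlt)// ge_min lexx orbT.
have e20 : 0 < e / 2 by rewrite divr_gt0.
suff : S (sup S + e / 2).
  by move=> /(ub_le_sup hS.2); rewrite gerDl leNgt e20.
split; first by rewrite addr_ge0// ltW.
exists (e / 2) => // w wlt; apply: eP.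
rewrite (le_lt_trans (normc_trg (ray z (sup S + e / 2)) _ _))//.
by rewrite [ltRHS](splitr e) ltr_leD// ray_dist addrAC subrr add0r gtr0_norm.
Qed.

(** If the kernels of the powers did not become stationary, the kernel would
    meet all ranges and [z] would be a limit of eigenvalues. *)
Lemma root_space_finite z : ~ Rc z -> finite_dimensional (root_space A z).
Proof.
move=> Rz; have pz := shift_invertible_proper (inv Rz).
have [hz|] := pselect (kernel_meets_ranges A z).
  exfalso; apply: (eigenvalues_isolated Rz) => e e0.
  have [d d0 dP] := kernel_meets_ranges_open UU Uoo bA pz hz.
  have mpos : 0 < Num.min e d by rewrite lt_min e0.
  pose m := Num.min e d / 2; have m0 : 0 < m by rewrite divr_gt0.
  have mlt : m < Num.min e d by rewrite ltr_pdivrMr// mulr2n mulrDr mulr1 ltrDl.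
  have wz : normc (ray z m - z) = m.
    by rewrite -{2}[z]ray0 ray_dist subr0 gtr0_norm.
  exists (ray z m); split.
  - by rewrite -{2}[z]ray0 ray_neq// gt_eqF.
  - by rewrite wz (lt_le_trans mlt)// ge_min lexx.
  - apply: dP; first by rewrite wz (lt_le_trans mlt)// ge_min lexx orbT.
    by apply/shift_invertible_proper/inv => -[r _ /esym]; exact: ray_nonreal.
move=> nh; have [k kP] : exists k, forall u v,
    pencil A z u = 0 -> iter k (pencil A z) v = u -> u = 0.
  apply: contrapT => H'; apply: nh => k; apply: contrapT => H''; apply: H'.
  exists k => u v Tu vu; apply: contrapT => /eqP u0; apply: H''.
  by exists u, v.
have bk := bounded_op_iter k (bounded_pencil bA z).
have [n [e eP]] := proper_op_ker_finite UU Uoo bk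
  (proper_op_iter (k := k) (bounded_pencil bA z) pz).
exists n, e => u [j uj]; apply: eP => /=.
have {}uj : iter j (pencil A z) u = 0 := uj.
have [jk|/ltnW kj] := leqP j k.
  by rewrite -(subnK jk) iterD uj (lin0 (bounded_op_iter _ (bounded_pencil bA z)).1).
rewrite -(subnKC kj) in uj; elim: (j - k)%N uj => [|i ih]; first by rewrite addn0.
rewrite addnS iterS => Tu; apply: ih; apply: (kP _ _ Tu).
by rewrite iterD.
Qed.

Hypothesis Rh_closed : closed Rh.

Lemma dist_real_gt0 z : ~ Rc z ->
  exists2 e : R, 0 < e & forall r, Rh r -> e <= normc (z - r%:C).
Proof.
move=> Rz; have [Iz|Iz] := eqVneq (complex.Im z) 0; last first.
  exists `|complex.Im z| => [|r _]; first by rewrite normr_gt0.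
  by have := Im_le_normc (z - r%:C); case: (z) => a b /=; rewrite subr0.
have zE : z = (complex.Re z)%:C by move: Iz; case: (z) => a b /= ->.
have nR : (~` Rh) (complex.Re z) by move=> zR; apply: Rz; exists (complex.Re z).
have oR : open (~` Rh) by exact: closed_openC.
have /nbhs_ballP[e /= e0 eR] := open_nbhs_nbhs (conj oR nR).
exists e => // r Rr; rewrite leNgt; apply/negP => lt.
apply: eR Rr; rewrite /ball /=.
by move: lt; rewrite zE -rmorphB normc_real.
Qed.

Let E : set R[i] := spectrum A `\` Rc.

Lemma off_range_eigenvalue z : E z -> eigenvalue_op A z.
Proof.
move=> [sz Rz]; apply: contrapT => nz; apply: sz.
by apply: shift_invertible_resolvent => //; exact: inv.
Qed.

Lemma off_range_isolated z : ~ Rc z -> exists2 e : R, 0 < e &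
  forall w, E w -> w != z -> e <= normc (w - z).
Proof.
move=> /eigenvalues_isolated H'; apply: contrapT => H''; apply: H' => e e0.
apply: contrapT => H'; apply: H''; exists e => // w Ew wz.
rewrite leNgt; apply/negP => lt; apply: H'; exists w; split=> //.
exact: off_range_eigenvalue.
Qed.

(** A limit point off the range would be an isolated point that an injective
    sequence of eigenvalues approaches. *)
Lemma off_range_ulim (f : nat -> R[i]) : injective f -> (forall n, E (f n)) ->
  exists2 r, Rc r & ulim U (f : nat -> R[i]^o) r.
Proof.
move=> injf Ef; have [c c0 eigc] := eigenvalue_bounded.
have [l fl] := @complex_bounded_ulim _ _ UU (f : nat -> R[i]^o) c
  (fun n => eigc _ (off_range_eigenvalue (Ef n))).
exists l => //; apply: contrapT => /off_range_isolated[e e0 eE].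
have [n [m [/= fn fm nm]]] := ultra_pair UU Uoo succn (fl e e0).
rewrite rnorm_complex in fn; rewrite rnorm_complex in fm.
have [fnl|fnl] := eqVneq (f n) l; last by have := eE _ (Ef n) fnl; rewrite leNgt fn.
have [fml|fml] := eqVneq (f m) l; last by have := eE _ (Ef m) fml; rewrite leNgt fm.
by have := injf n m; rewrite fnl fml => /(_ erefl) nmE; rewrite nmE ltnn in nm.
Qed.

(** At distance at least [n.+1%:R^-1] from the range there are finitely many
    points of the spectrum, since infinitely many would accumulate off the
    range. *)
Lemma off_range_countable : countable E.
Proof.
pose D n := [set z | E z /\ forall r, Rh r -> n.+1%:R^-1 <= normc (z - r%:C)].
apply: (@sub_countable _ _ _ (\bigcup_(n in [set: nat]) D n)).
  apply: subset_card_le => z Ez; have [e e0 eR] := dist_real_gt0 Ez.2.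
  have [n /= ne] := ultra_ex UU (ultra_invn Uoo e0).
  by exists n => //; split=> // r /eR; exact: le_trans (ltW ne).
apply: bigcup_countable => // n _; apply: finite_set_countable.
apply: contrapT => /infinite_injection[f injf Df].
have [l [r Rr <-] fl] := off_range_ulim injf (fun n => (Df n).1).
have n0 : (0 : R) < n.+1%:R^-1 by rewrite invr_gt0 ltr0Sn.
have [m /=] := ultra_ex UU (fl _ n0); rewrite rnorm_complex.
by have := (Df m).2 _ Rr; rewrite leNgt => /negP.
Qed.

Hypothesis Rh_spectrum : Rc `<=` spectrum A.

Theorem compact_minus_multiplication_spectrum : spectrum_description A Rh.
Proof.
have spE : spectrum A = Rc `|` E by rewrite /E setDUK.
have [fE|iE] := pselect (finite_set E).
  have [n] := (finite_setP _).1 fE; rewrite card_eq_sym.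
  move=> /(@card_set_bijP _ R[i]^o)[z [zE zinj zsurj]].
  exists (Some n), z; split=> //.
  rewrite spE; congr (_ `|` _); apply/seteqP; split=> // _ [k kn <-].
  exact: zE.
have := eq_card_nat off_range_countable iE; rewrite card_eq_sym.
move=> /(@card_set_bijP _ R[i]^o)[z [zE zinj zsurj]].
have injz : injective z by move=> m n; apply: zinj; rewrite inE.
have Ez n : E (z n) by exact: zE.
exists None, z; split=> //.
  rewrite spE; congr (_ `|` _); apply/seteqP; split=> // _ [k kn <-].
  exact: zE.
move=> _; split=> [n|].
  split; first exact: off_range_eigenvalue.
  by apply: root_space_finite; exact: (Ez n).2.
split.
  have [l _ zl] := off_range_ulim injz Ez; exists l => S B zS /nbhs_ballP[e /= e0 eB].
  have eE : e = (complex.Re e)%:C.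
    by move: e0; case: e {eB} => a b; rewrite ltcE /= => /andP[/eqP -> _].
  have e0' : 0 < complex.Re e by rewrite -ltcR -eE.
  have UF := ultra_filter UU.
  have [n /= [Sn ln]] := ultra_ex UU (filterI (Uoo zS) (zl _ e0')).
  exists (z n); split=> //; apply: eB; rewrite -ball_normE /=.
  by rewrite eE rnormE ltcR rnormC.
move=> l cl; apply: contrapT => Rl.
have [e e0 eE] := off_range_isolated Rl.
have [N NP] : exists N, forall n, (N <= n)%N -> z n != l.
  have [[k zk]|nk] := pselect (exists k, z k = l); last first.
    by exists 0%N => n _; apply/eqP => zn; apply: nk; exists n.
  exists k.+1 => n kn; apply/eqP => zn.
  by have := injz n k; rewrite zn zk => /(_ erefl) nk; rewrite nk ltnn in kn.
have [||w [/= [n Nn <-]]] := cl (z @` [set n | (N <= n)%N]) (ball (l : R[i]^o) e%:C).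
- by exists N => // n /= Nn; exists n.
- by apply: nbhsx_ballx; rewrite ltcR.
rewrite -ball_normE /= => lt.
have := eE _ (Ez n) (NP _ Nn); rewrite leNgt normcBC => /negP; apply.
by move: lt; rewrite rnormE rnorm_complex ltcR.
Qed.

End compact_minus_multiplication.

(** * Bounded inverses of shifted multipliers *)

Lemma continuous_maxr (R : realType) (T : topologicalType) (f : T -> R) (c : R) :
  continuous f -> continuous (fun x => Num.max (f x) c).
Proof.
move=> cf x; rewrite (_ : (fun x => Num.max (f x) c) =
    fun x => (f x + c + `|f x - c|) / 2); last first.
  by apply/funext => y; rewrite maxr_absE.
apply: cvgM; last exact: cvg_cst.
apply: cvgD; first by apply: cvgD; [exact: cf|exact: cvg_cst].
by apply: cvg_norm; apply: cvgB; [exact: cf|exact: cvg_cst].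
Qed.

Section cut_inverse.
Context (R : realType).
Implicit Types (z : R[i]) (e t : R).

(** The function [1 / (t + z)], modified near its pole so as to be continuous
    and bounded on the whole line. *)
Definition cut_inverse z e t : R[i] :=
  let D := Num.max ((t + complex.Re z) ^+ 2 + complex.Im z ^+ 2) (e ^+ 2) in
  ((t + complex.Re z) / D +i* (- complex.Im z / D))%C.

Lemma cut_inverseK z e t : 0 < e -> e <= normc (t%:C + z) ->
  cut_inverse z e t * (t%:C + z) = 1.
Proof.
move=> e0; rewrite Defs.normcE /cut_inverse; case: z => a b /=; rewrite add0r => le.
have N0 : 0 <= (t + a) ^+ 2 + b ^+ 2 by rewrite addr_ge0 ?sqr_ge0.
have eN : e ^+ 2 <= (t + a) ^+ 2 + b ^+ 2.
  by rewrite -[leRHS]sqr_sqrtr// lerXn2r ?nnegrE ?sqrtr_ge0// ltW.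
rewrite (max_idPl eN); set N := (t + a) ^+ 2 + b ^+ 2 in eN *.
have Npos : 0 < N by apply: lt_le_trans eN; rewrite exprn_gt0.
apply/eqP; rewrite eq_complex /= add0r; apply/andP; split; apply/eqP.
  have -> : (t + a) / N * (t + a) - - b / N * b = ((t + a) ^+ 2 + b ^+ 2) / N.
    by ring.
  by rewrite divff// gt_eqF.
by ring.
Qed.

Lemma cut_inverse_bound z e t : 0 < e -> normc (cut_inverse z e t) <= e^-1.
Proof.
move=> e0; rewrite Defs.normcE /cut_inverse; case: z => a b /=.
set N := (t + a) ^+ 2 + b ^+ 2; set D := Num.max N (e ^+ 2).
have N0 : 0 <= N by rewrite addr_ge0 ?sqr_ge0.
have eD : e ^+ 2 <= D by rewrite le_max lexx orbT.
have D0 : 0 < D by apply: lt_le_trans eD; rewrite exprn_gt0.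
have -> : ((t + a) / D) ^+ 2 + (- b / D) ^+ 2 = N / D ^+ 2.
  by rewrite !expr_div_n sqrrN -mulrDl.
have -> : e^-1 = Num.sqrt (e^-1 ^+ 2) by rewrite sqrtr_sqr gtr0_norm ?invr_gt0.
rewrite ler_sqrt ?sqr_ge0//.
rewrite exprVn ler_pdivrMr ?exprn_gt0// mulrC ler_pdivlMr ?exprn_gt0//.
by rewrite expr2 ler_pM ?sqr_ge0// le_max lexx.
Qed.

Lemma cut_inverse_continuous z e : 0 < e ->
  continuous (fun t => complex.Re (cut_inverse z e t)) /\
  continuous (fun t => complex.Im (cut_inverse z e t)).
Proof.
move=> e0; rewrite /cut_inverse /=.
set a := complex.Re z; set b := complex.Im z.
have cN : continuous (fun t : R => t + a).
  by move=> t; apply: cvgD; [exact: cvg_id|exact: cvg_cst].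
have cD : continuous (fun t : R => Num.max ((t + a) ^+ 2 + b ^+ 2) (e ^+ 2)).
  apply: continuous_maxr => t; apply: cvgD; last exact: cvg_cst.
  by rewrite expr2; apply: cvgM; exact: cN.
have D0 t : Num.max ((t + a) ^+ 2 + b ^+ 2) (e ^+ 2) != 0.
  by rewrite gt_eqF// lt_max exprn_gt0 ?orbT.
split=> t; apply: cvgM; first exact: cN.
- by apply: cvgV => //; exact: cD.
- exact: cvg_cst.
- by apply: cvgV => //; exact: cD.
Qed.

End cut_inverse.

(** * Points of the closed range belong to the spectrum *)

Section approximate_spectrum.
Context (R : realType) (U : set_system nat).
Hypothesis UU : UltraFilter U.
Hypothesis Uoo : \oo `<=` U.
Context (V : normedModType R[i]).
Variables (K H : V -> V).
Hypotheses (bK : bounded_op K) (cK : compact_ulim_op U K) (bH : bounded_op H).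

(** If [K - H - z] had a bounded inverse, then on vectors that [H + z] almost
    annihilates the norm would be controlled by [K] alone, so a separated
    family would be mapped by the compact [K] to a separated family. *)
Lemma approximate_spectrum (z : R[i]) :
  (forall (e : R) (N : nat), 0 < e -> exists u : nat -> V,
     (forall i, (i <= N)%N -> rnorm (u i) = 1 /\ rnorm (H (u i) + z *: u i) <= e) /\
     (forall i j, (i < j)%N -> (j <= N)%N -> 1 <= rnorm (u j - u i))) ->
  spectrum (fun u => K u - H u) z.
Proof.
move=> approx [S [cS SA _]]; have UF := ultra_filter UU.
have [lS [c c0 Sc]] := continuous_bounded_op cS.
pose e := (4 * (c + 1))^-1; have c10 : 0 < c + 1 by rewrite ltr_wpDl.
have e0 : 0 < e by rewrite invr_gt0 mulr_gt0.
have /choice[u uP] N := approx e N e0.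
have sep N i j : (i < j)%N -> (j <= N)%N ->
    (2 * (c + 1))^-1 <= rnorm (K (u N j) - K (u N i)).
  move=> ij jN; have [uN usep] := uP N; have iN := leq_trans (ltnW ij) jN.
  have := usep _ _ ij jN; set v := u N j - u N i => v1.
  have Hv : rnorm (H v + z *: v) <= e + e.
    have -> : H v + z *: v = (H (u N j) + z *: u N j) - (H (u N i) + z *: u N i).
      by rewrite /v (linB _ _ bH.1) scalerBr opprD addrACA.
    by rewrite (le_trans (rnormB _ _))// lerD// (uN _ _).2.
  have vle : rnorm v <= (c + 1) * (rnorm (K v) + (e + e)).
    rewrite -{1}[v]SA (le_trans (Sc _))//.
    rewrite (@le_trans _ _ ((c + 1) * rnorm (K v - H v - z *: v)))//.
      by rewrite ler_wpM2r ?rnorm_ge0// lerDl.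
    rewrite ler_pM2l// -addrA -opprD (le_trans (rnormB _ _))//.
    by rewrite lerD2l.
  rewrite -(linB _ _ bK.1) -/v invfM -[leRHS](mulKf (lt0r_neq0 c10)) mulrC.
  rewrite ler_pM2l ?invr_gt0//.
  have eE : (c + 1) * (e + e) = 2^-1.
    rewrite /e invfM mulrDr mulrCA mulfV ?gt_eqF//; lra.
  by move: (le_trans v1 vle); rewrite mulrDr eE; lra.
(* a diagonal argument over the finite families: first the [i]-th members
   converge as [N] varies, then the limits [y i] converge *)
pose s i N := if (i <= N)%N then u N i else 0.
have s1 i N : rnorm (s i N) <= 1.
  rewrite /s; case: ifPn => [iN|_]; last by rewrite rnorm0.
  by rewrite ((uP N).1 i iN).1.
have /choice[y yP] i := cK (s1 i).
have /choice[n nP] i : exists N, rnorm (K (s i N) - y i) < i.+1%:R^-1.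
  have i0 : (0 : R) < i.+1%:R^-1 by rewrite invr_gt0 ltr0Sn.
  by have [N] := ultra_ex UU (yP i _ i0); exists N.
have [l tl] := cK (s := fun i => s i (n i)) (c := 1) (fun i => s1 i (n i)).
have yl : ulim U y l.
  rewrite -[l]subr0; apply: (ulim_near UU (s := fun i => K (s i (n i)) -
      (K (s i (n i)) - y i))).
    by apply: filterE => i /=; rewrite subKr.
  apply: ulimB => //; apply: (@ulim_le _ _ UU _ _ _ (fun i => i.+1%:R^-1)).
    by move=> i; rewrite subr0 ltW.
  exact: ultra_invn.
have d0 : 0 < (2 * (c + 1))^-1 by rewrite invr_gt0 mulr_gt0.
have [i [j [ij]]] := ulim_cauchy UU Uoo succn yl d0.
apply/negP; rewrite -leNgt.
apply: (ulim_norm_ge UU (ulimB UU (yP j) (yP i))).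
apply: filterS (ultra_ge Uoo j) => N /= jN.
by rewrite /s jN (leq_trans (ltnW ij) jN) sep.
Qed.

End approximate_spectrum.

Section separated_points.
Context (R : realType) (T : metricType R).

Lemma finite_pos_lower_bound (a : nat -> R) N : (forall i, 0 < a i) ->
  exists2 r, 0 < r & forall i, (i <= N)%N -> r <= a i.
Proof.
move=> a0; elim: N => [|N [r r0 ra]].
  by exists (a 0%N) => // i; rewrite leqn0 => /eqP ->.
exists (Num.min r (a N.+1)) => [|i]; first by rewrite lt_min r0 a0.
rewrite leq_eqVlt => /orP[/eqP ->|/ra]; first by rewrite ge_min lexx orbT.
by move=> le; rewrite ge_min le.
Qed.

Lemma infinite_disjoint_balls (A : set T) N : infinite_set A ->
  exists2 x : nat -> T, (forall i, A (x i)) & exists2 r : R, 0 < r &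
    forall i j y, (i < j)%N -> (j <= N)%N -> ball (x i) r y -> ~ ball (x j) r y.
Proof.
move=> /infinite_injection[x injx Ax]; exists x => //.
pose a i j := if i == j then 1 else mdist (x i) (x j) / 2.
have a0 i j : 0 < a i j.
  rewrite /a; case: eqVneq => // ij.
  by rewrite divr_gt0// mdist_gt0; apply: contra ij => /eqP/injx ->.
have /choice[r rP] i : exists r, 0 < r /\ forall j, (j <= N)%N -> r <= a i j.
  by have [r ? ?] := finite_pos_lower_bound N (a0 i); exists r.
have [d d0 dr] := finite_pos_lower_bound N (fun i => (rP i).1).
exists d => // i j y ij jN; rewrite ballEmdist /= => iy; rewrite ballEmdist /= => jy.
have da : d <= a i j.
  exact: le_trans (dr _ (leq_trans (ltnW ij) jN)) ((rP i).2 _ jN).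
have := metric_triangle (x i) y (x j); apply/negP; rewrite -ltNge.
rewrite (metric_sym y).
move: da; rewrite /a (ltn_eqF ij) ler_pdivlMr// => /(lt_le_trans _); apply.
by rewrite mulr2n mulrDr mulr1 ltrD.
Qed.

End separated_points.

(** * Multiplication operators on Lebesgue spaces *)

Section Lp_multipliers.
Context d (T : measurableType d) (R : realType).
Variables (mu : {measure set T -> \bar R}) (p : \bar R) (p1 : (1 <= p)%E).
Local Open Scope quotient_scope.
Local Notation Lp := (LpC mu p1).
Implicit Types (f g : Lp) (L Q : Lp -> Lp) (m : T -> R[i]).

(** A representative of the class, with its type fixed so that it can be
    evaluated at points. *)
Definition rep f : Lfunc mu p1 := repr f.

Lemma LpC_eqP f g : {ae mu, forall x, rep f x = rep g x} -> f = g.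
Proof. by move=> fg; rewrite -[f]reprK -[g]reprK; apply/eq_LpCP. Qed.

Lemma rep_pi (u : Lfunc mu p1) : {ae mu, forall x, rep (\pi_Lp u) x = u x}.
Proof. exact: LpC_reprP. Qed.

Lemma rep_lin a f g : {ae mu, forall x, rep (a *: f + g) x = a * rep f x + rep g x}.
Proof.
have -> : a *: f + g = \pi_Lp (a *: (repr f : Lfunc mu p1) + repr g).
  by rewrite LpC_piD LpC_piZ !reprK.
exact: rep_pi.
Qed.

Lemma rep_0 : {ae mu, forall x, rep (0 : Lp) x = 0}.
Proof. by have := rep_pi 0; rewrite pi_zeror. Qed.

Lemma rnorm_LpC f : rnorm f = normLpC f.
Proof. by rewrite /rnorm normr_LpCE. Qed.

Lemma LpC_norm_le (c : R) f g : 0 <= c ->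
  {ae mu, forall x, normc (rep f x) <= c * normc (rep g x)} ->
  rnorm f <= c * rnorm g.
Proof.
move=> c0 fg; rewrite !rnorm_LpC -lee_fin EFinM !normLpCE.
rewrite -[c](ger0_norm c0) -LnormZ.
pose w : LfunType mu p1 := c *: modulus (rep g).
rewrite -[leRHS]/('N[mu]_p[EFin \o w])%E.
apply: ae_le_Lnorm => //; apply: filterS fg => x fg.
rewrite ger0_norm ?normc_ge0// ger0_norm; last first.
  by rewrite mulr_ge0 ?normc_ge0.
exact: fg.
Qed.

Lemma LpC_norm_le1 f g :
  {ae mu, forall x, normc (rep f x) <= normc (rep g x)} -> rnorm f <= rnorm g.
Proof.
move=> fg; rewrite -[leRHS]mul1r; apply: LpC_norm_le => //.
by apply: filterS fg => x; rewrite mul1r.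
Qed.

Definition multiplies L m : Prop :=
  forall f, {ae mu, forall x, rep (L f) x = m x * rep f x}.

Lemma multiplies_bounded L m (c : R) : 0 <= c -> multiplies L m ->
  {ae mu, forall x, normc (m x) <= c} -> bounded_op L.
Proof.
move=> c0 Lm mc; split=> [a f g|].
  apply: LpC_eqP.
  apply: filterS2 (filterI (Lm (a *: f + g)) (rep_lin a f g))
    (filterI (rep_lin a (L f) (L g)) (filterI (Lm f) (Lm g))) => x.
  by move=> [-> ->] [-> [-> ->]]; rewrite mulrDr mulrCA.
exists c => // f; apply: LpC_norm_le => //.
apply: filterS2 (Lm f) mc => x -> mxc.
by rewrite normcM ler_wpM2r ?normc_ge0.
Qed.

Lemma multiplies_inverse L Q m m' z : multiplies L m -> multiplies Q m' ->
  {ae mu, forall x, m' x * (m x + z) = 1} ->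
  (forall f, Q (L f + z *: f) = f) /\ (forall f, L (Q f) + z *: Q f = f).
Proof.
move=> Lm Qm mm'; split=> f; rewrite addrC; apply: LpC_eqP.
  apply: filterS2 (filterI (Qm (z *: f + L f)) (rep_lin z f (L f)))
    (filterI (Lm f) mm') => x [-> ->] [-> mx].
  by rewrite -mulrDl addrC mulrA mx mul1r.
apply: filterS2 (filterI (Lm (Q f)) (rep_lin z (Q f) (L (Q f))))
  (filterI (Qm f) mm') => x [Lx ->] [Qx mx].
by rewrite Lx Qx -mulrDl addrC mulrCA mulrA mx mul1r.
Qed.

Lemma multiplies_exists m (c : R) :
  measurable_fun [set: T] (fun x => complex.Re (m x)) ->
  measurable_fun [set: T] (fun x => complex.Im (m x)) ->
  0 <= c -> (forall x, normc (m x) <= c) -> exists Q, multiplies Q m.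
Proof.
move=> mr mi c0 mc.
have mP (u : Lfunc mu p1) : (fun x => m x * u x) \in Lfunc_pred mu p1.
  have := lfuncP u; rewrite inE => -[ur ui uf].
  have pr : measurable_fun [set: T] (@complex.Re R \o (fun x => m x * u x)).
    rewrite (_ : _ \o _ = fun x => complex.Re (m x) * (@complex.Re R \o u) x -
        complex.Im (m x) * (@complex.Im R \o u) x).
      by apply: measurable_funB; exact: measurable_funM.
    by apply/funext => x /=; have := ReMD (m x) (u x) 0; rewrite !addr0.
  have pi : measurable_fun [set: T] (@complex.Im R \o (fun x => m x * u x)).
    rewrite (_ : _ \o _ = fun x => complex.Re (m x) * (@complex.Im R \o u) x +
        complex.Im (m x) * (@complex.Re R \o u) x).
      by apply: measurable_funD; exact: measurable_funM.
    by apply/funext => x /=; have := ImMD (m x) (u x) 0; rewrite !addr0.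
  rewrite inE; split=> //.
  pose w : LfunType mu p1 := c *: modulus u.
  apply: (@le_lt_trans _ _ 'N[mu]_p[EFin \o w]%E); last exact: Lfunction_finite.
  apply: ae_le_Lnorm => //; first exact: measurable_normc.
  apply: nearW => x; rewrite ger0_norm ?normc_ge0// (le_trans _ (ler_norm _))//=.
  by rewrite normcM ler_wpM2r ?normc_ge0.
exists (fun f => \pi_Lp (LFunc (mP (rep f)))) => f; exact: rep_pi.
Qed.

Lemma mulLp_multiplies (h : LfunType mu (leey 1)) :
  multiplies (mulLp (p1 := p1) h) (fun x => (h x)%:C).
Proof. by move=> f; exact: rep_pi. Qed.

Lemma Linfty_ae_bounded (h : LfunType mu (leey 1)) :
  exists2 c : R, 0 <= c & {ae mu, forall x, `|h x| <= c}.
Proof.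
exists (fine 'N[mu]_+oo[EFin \o h]%E).
  by rewrite fine_ge0// Lnorm_ge0.
have [mu0|mu0] := ltP 0%E (mu [set: T]); last first.
  by exists [set: T]; split=> //; apply/eqP; rewrite -measure_le0.
have := @ess_sup_ge _ _ _ mu (abse \o (EFin \o h)).
apply: filterS => x; rewrite -lee_fin finite_norm_fine.
by rewrite unlock /Lnorm mu0.
Qed.

Lemma mulLp_bounded (h : LfunType mu (leey 1)) :
  bounded_op (mulLp (p1 := p1) h).
Proof.
have [c c0 hc] := Linfty_ae_bounded h.
apply: (multiplies_bounded c0 (@mulLp_multiplies h)).
by apply: filterS hc => x; rewrite normc_real.
Qed.

Lemma mulLp_shift_invertible (h : LfunType mu (leey 1)) (z : R[i]) (e : R) :
  0 < e -> {ae mu, forall x, e <= normc ((h x)%:C + z)} ->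
  shift_invertible (mulLp (p1 := p1) h) z.
Proof.
move=> e0 he; have [cr ci] := cut_inverse_continuous z e0.
have mh : measurable_fun [set: T] h by [].
have [||||Q Qm] := @multiplies_exists (fun x => cut_inverse z e (h x)) e^-1.
- exact: (measurableT_comp (continuous_measurable_fun cr) mh).
- exact: (measurableT_comp (continuous_measurable_fun ci) mh).
- by rewrite invr_ge0 ltW.
- by move=> x; exact: cut_inverse_bound.
have [|QL LQ] := multiplies_inverse (z := z) (@mulLp_multiplies h) Qm.
  by apply: filterS he => x; exact: cut_inverseK.
exists Q; split=> //; apply: (multiplies_bounded (c := e^-1) _ Qm).
  by rewrite invr_ge0 ltW.
by apply: nearW => x; exact: cut_inverse_bound.
Qed.

End Lp_multipliers.

(** * Essential range and local support of a regular measure *)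

Section essential_range.
Context (R : realType) d (T : metricMeasurableType R d).
Variable mu : {measure set T -> \bar R}.

Lemma measurable_preimage_ball (f : T -> R) y e : measurable_fun [set: T] f ->
  measurable (f @^-1` ball y e).
Proof.
move=> mf; rewrite -[X in measurable X]setTI; apply: mf => //.
exact: measurable_ball.
Qed.

Lemma ess_range_closed (f : T -> R) : measurable_fun [set: T] f ->
  closed (ess_range mu f).
Proof.
move=> mf; rewrite -[X in closed X]setCK; apply: open_closedC.
rewrite openE => y; rewrite /ess_range /= => /existsNP[e /not_implyP[e0 ye]].
have e20 : 0 < e / 2 by rewrite divr_gt0.
apply/nbhs_ballP; exists (e / 2) => //= y' yy' /(_ _ e20); apply: contra_not ye.
move=> /lt_le_trans; apply; apply: le_measure;
  try by apply: mem_set; exact: measurable_preimage_ball.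
by move=> x /= y'x; rewrite (splitr e); exact: ball_triangle yy' y'x.
Qed.

Lemma ess_range_opp (h : T -> R) r e : (fun x => - h x) @^-1` ball r e =
  h @^-1` ball (- r) e.
Proof.
have E x : `|r - - h x| = `|- r - h x| by rewrite -[RHS]normrN opprD !opprK.
by apply/seteqP; split=> x; rewrite -ball_normE /= E.
Qed.

Definition local_support (B : set T) : set T :=
  [set x | forall e : R, 0 < e -> (0 < mu (B `&` ball x e))%E].

Lemma metric_ball_open x (e : R) : open (ball x e : set T).
Proof.
rewrite openE => y; rewrite ballEmdist /= => xy.
apply/nbhs_ballP; exists (e - mdist x y) => /=; first by rewrite subr_gt0.
move=> z; rewrite ballEmdist /= ltrBrDl => yz.
by rewrite (le_lt_trans (metric_triangle _ y _)).
Qed.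

Hypothesis hmu : metric_measure mu.

Lemma measurable_metric_ball x (e : R) : measurable (ball x e : set T).
Proof. by apply: (mm_borel hmu); exact: metric_ball_open. Qed.

(** Points of [B] near which [B] has no mass form a null set: a compact part of
    it is covered by finitely many null sets, and the measure is inner
    regular. *)
Lemma local_support_full (B : set T) : measurable B ->
  mu.-negligible (B `\` local_support B).
Proof.
move=> mB; set S := local_support B.
have mBx x e : measurable (B `&` ball x e).
  by apply: measurableI => //; exact: measurable_metric_ball.
have /choice[e eP] x : exists e : R, ~ S x -> 0 < e /\ mu (B `&` ball x e) = 0%E.
  have [Sx|] := pselect (S x); first by exists 0.
  move=> /existsNP[e /not_implyP[e0 xe]]; exists e => _; split=> //.
  by apply/eqP; rewrite -measure_le0 leNgt; apply/negP.
have oS : open (~` S).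
  rewrite openE => x Sx; have [e0 ex] := eP x Sx.
  apply/nbhs_ballP; exists (e x / 2) => /=; first by rewrite divr_gt0.
  move=> y xy /(_ (e x / 2)); rewrite divr_gt0// => /(_ isT).
  apply/negP; rewrite -leNgt -ex; apply: le_measure; try exact: mem_set.
  by apply: setIS => z yz; rewrite (splitr (e x)); exact: ball_triangle xy yz.
have mBS : measurable (B `\` S).
  by rewrite setDE; apply: measurableI => //; exact: (mm_borel hmu).
suff mu0 : mu (B `\` S) = 0%E by exact/(negligibleP mu mBS).
have E : mu (B `\` S) =
  ereal_sup [set mu C | C in [set C | compact C /\ C `<=` B `\` S]].
  exact: (mm_regular hmu mBS).2.
apply/le_anti/andP; split; last exact: measure_ge0.
rewrite E; apply: ge_ereal_sup => _ [C [cC CBS] <-].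
have mC : measurable C.
  rewrite -[X in measurable X]setCK; apply: measurableC; apply: (mm_borel hmu).
  by apply: closed_openC; apply: compact_closed => //; exact: metric_hausdorff.
rewrite measure_le0; apply/eqP/(negligibleP mu mC).
move: (cC); rewrite compact_cover => /(_ T C (fun x => ball x (e x))).
move=> [x _|x Cx|D DC CD]; first exact: metric_ball_open.
  by exists x => //; apply: ballxx; case: (eP x) => //; exact: (CBS _ Cx).2.
have CD' : C `<=` \bigcup_(x in [set` D]) (B `&` ball x (e x)).
  move=> x Cx; have [y Dy xy] := CD x Cx.
  by exists y => //; split=> //; exact: (CBS _ Cx).1.
apply: (negligibleS CD').
rewrite bigcup_fset big_seq; apply: big_ind.
- exact: negligible_set0.
- by move=> X Y; exact: negligibleU.
- move=> x xD; apply/(negligibleP mu (mBx x (e x))).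
  have /(DC x)/set_mem Cx := xD.
  by case: (eP x) => //; exact: (CBS _ Cx).2.
Qed.

Lemma local_support_infinite (B : set T) : measurable B ->
  (~ exists F : set T, finite_set F /\ mu.-negligible (B `\` F)) ->
  infinite_set (local_support B).
Proof.
move=> mB nF fS; apply: nF; exists (local_support B); split=> //.
exact: local_support_full.
Qed.

End essential_range.

(** * The spectrum on Lebesgue spaces *)

Section Lp_separated.
Context (R : realType) d (T : metricMeasurableType R d).
Variables (mu : {measure set T -> \bar R}) (p : \bar R) (p1 : (1 <= p)%E).
Hypothesis hmu : metric_measure mu.
Local Open Scope quotient_scope.
Local Notation Lp := (LpC mu p1).

Lemma indic_Lfunc (E : set T) : measurable E -> (mu E < +oo)%E ->
  (fun x => (\1_E x : R)%:C) \in Lfunc_pred mu p1.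
Proof.
move=> mE muE; rewrite inE; split.
- exact: (measurable_indic mE).
- exact: measurable_cst.
rewrite (_ : _ \o _ = (\1_E : T -> R)); last first.
  by apply/funext => x; rewrite /comp normc_real ger0_norm.
rewrite /finite_norm unlock /Lnorm; case: p p1 => [r|_|//].
- rewrite lee_fin => r1; have r0 : r != 0 by rewrite gt_eqF// (lt_le_trans ltr01).
  apply: poweR_lty; rewrite (eq_integral (fun x => (\1_E x)%:E)).
    by rewrite integral_indic// setIT.
  move=> x _ /=; rewrite indicE; case: (x \in E) => /=.
    by rewrite normr1 powR1.
  by rewrite normr0 powR0.
- case: ifPn => // _; apply: le_lt_trans (ltry 1).
  apply: ess_sup_ler => x /=; rewrite lee_fin indicE.
  by case: (x \in E); rewrite ?normr1 ?normr0.
Qed.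

End Lp_separated.

Section Lp_spectrum.
Context (R : realType) d (T : metricMeasurableType R d).
Variables (mu : {measure set T -> \bar R}) (p : \bar R) (p1 : (1 <= p)%E).
Hypothesis hmu : metric_measure mu.
Variable h : LfunType mu (leey 1).
Local Open Scope quotient_scope.
Local Notation Lp := (LpC mu p1).

(** The [u i] are normalised indicators of disjoint parts of the set where [h]
    is within [e] of [- r]; disjointness of supports gives the separation in
    every [L^p] norm at once. *)
Lemma Lp_separated_near_kernel (r e : R) (N : nat) : no_finite_level mu h ->
  ess_range mu (fun x => - h x) r -> 0 < e -> exists u : nat -> Lp,
  (forall i, (i <= N)%N -> rnorm (u i) = 1 /\
    rnorm (mulLp (p1 := p1) h (u i) + r%:C *: u i) <= e) /\
  (forall i j, (i < j)%N -> (j <= N)%N -> 1 <= rnorm (u j - u i)).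
Proof.
move=> nf hr e0; have mh : measurable_fun [set: T] h by [].
pose B := h @^-1` ball (- r) e.
have mB : measurable B := measurable_preimage_ball (- r) e mh.
have Bpos : (0 < mu B)%E by have := hr e e0; rewrite ess_range_opp.
have [x Sx [r0 r00 dis]] := infinite_disjoint_balls N
  (local_support_infinite hmu mB (nf _ _ e0 Bpos)).
pose E i := B `&` ball (x i) r0.
have mE i : measurable (E i).
  by apply: measurableI => //; exact: (measurable_metric_ball hmu).
have Efin i : (mu (E i) < +oo)%E.
  have /andP[_] := mm_ball hmu (x i) r00; apply: le_lt_trans.
  apply: le_measure; try apply: mem_set => //; last exact: subIsetr.
  exact: (measurable_metric_ball hmu).
pose f i : Lp := \pi_Lp (LFunc (indic_Lfunc p1 (mE i) (Efin i))).
have fE i : {ae mu, forall x, rep (f i) x = (\1_(E i) x : R)%:C} := rep_pi _.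
have f0 i : 0 < rnorm (f i).
  apply: rnorm_gt0; apply/eqP => fi0.
  have := Sx i r0 r00; rewrite -[(_ < _)%E]negbK -leNgt measure_le0 => /negP; apply.
  apply/eqP/(negligibleP mu (mE i)).
  have : {ae mu, forall x, \1_(E i) x = 0 :> R}.
    have := fE i; rewrite fi0; apply: filterS2 (rep_0 mu p1) => y -> /esym.
    by move=> /complexI.
  by apply: negligibleS => y Ey /=; rewrite indicE mem_set//; exact/eqP/oner_neq0.
pose a i := ((rnorm (f i))^-1)%:C.
pose u i := a i *: f i.
have uE i : {ae mu, forall x, rep (u i) x = a i * (\1_(E i) x : R)%:C}.
  apply: filterS3 (rep_lin (a i) (f i) 0) (fE i) (rep_0 mu p1) => y.
  by rewrite addr0 => -> -> ->; rewrite addr0.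
have u1 i : rnorm (u i) = 1.
  rewrite rnormZ normc_real ger0_norm ?invr_ge0 ?rnorm_ge0//.
  by rewrite mulVf// gt_eqF.
exists u; split=> [i iN|i j ij jN]; first split=> //.
  rewrite -[leRHS]mulr1 -(u1 i) addrC; apply: LpC_norm_le; first exact: ltW.
  apply: filterS3 (rep_lin r%:C (u i) (mulLp (p1 := p1) h (u i)))
    (mulLp_multiplies (p1 := p1) h (u i)) (uE i) => y -> -> ->.
  rewrite -mulrDl normcM -rmorphD normc_real.
  have [yE|yE] := pselect (E i y); last first.
    by rewrite indicE memNset// mulr0 normc0 !mulr0.
  apply: ler_wpM2r; first exact: normc_ge0.
  have := yE.1; rewrite /B -ball_normE /= -normrN opprD !opprK => /ltW.
  by [].
rewrite -(u1 j); apply: LpC_norm_le1.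
rewrite -scaleN1r addrC.
apply: filterS3 (rep_lin (-1) (u i) (u j)) (uE i) (uE j) => y -> -> ->.
have out k : ~ E k y -> \1_(E k) y = 0 :> R by move=> ?; rewrite indicE memNset.
have [yj|yj] := pselect (E j y); last by rewrite (out j)// mulr0 normc0 normc_ge0.
have yi : ~ E i y by move=> [_ yi]; exact: (dis i j y ij jN yi) yj.2.
by rewrite (out i)// mulr0 mulr0 add0r.
Qed.

Theorem Lp_spectrum_description (K : {linear Lp -> Lp}) :
  no_finite_level mu h -> continuous K -> compact_operator K ->
  spectrum_description (fun u => K u - mulLp (p1 := p1) h u)
    (ess_range mu (fun x => - h x)).
Proof.
move=> nf cK kK.
have [U [UU Uoo]] := ultraFilterLemma (F := \oo) _.
have mh : measurable_fun [set: T] h by [].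
have mNh : measurable_fun [set: T] (fun x => - h x) by exact: measurableT_comp.
have bK := continuous_bounded_op cK.
have uK := compact_operator_ulim UU kK.
have bH := mulLp_bounded p1 h.
apply: (compact_minus_multiplication_spectrum UU Uoo bK uK bH).
- move=> z nz; have [Iz|Iz] := eqVneq (complex.Im z) 0; last first.
    apply: (mulLp_shift_invertible p1 (e := `|complex.Im z|)).
      by rewrite normr_gt0.
    apply: nearW => x; have := Im_le_normc ((h x)%:C + z).
    by case: (z) => a b /=; rewrite add0r.
  have zE : z = (complex.Re z)%:C by move: Iz; case: (z) => a b /= ->.
  have [e e0 ze] : exists2 e : R, 0 < e &
      mu ((fun x => - h x) @^-1` ball (complex.Re z) e) = 0%E.
    apply: contrapT => H'; apply: nz; exists (complex.Re z) => // e e0.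
    rewrite ltNge measure_le0; apply/eqP => ze; apply: H'; by exists e.
  apply: (mulLp_shift_invertible p1 e0).
  have mb := measurable_preimage_ball (complex.Re z) e mNh.
  have : mu.-negligible ((fun x => - h x) @^-1` ball (complex.Re z) e).
    by apply/(negligibleP mu mb).
  apply: negligibleS => x /= /negP; rewrite -ltNge zE -rmorphD normc_real => xe.
  by rewrite -ball_normE /= opprK addrC.
- exact: ess_range_closed.
- move=> _ [r rR <-].
  apply: (approximate_spectrum UU Uoo bK uK bH) => e N e0.
  exact: Lp_separated_near_kernel.
Qed.

End Lp_spectrum.

(** * The spectrum on bounded continuous functions *)

Section Cb_spectrum.
Context (R : realType) d (T : metricMeasurableType R d).
Variables (mu : {measure set T -> \bar R}).
Hypothesis hmu : metric_measure mu.
Variable h : Cb T R.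
Local Notation CbC := (Cb T R[i]).

Lemma rnorm_Cb (u : CbC) : rnorm u = normCb u.
Proof. by rewrite /rnorm normr_CbE. Qed.

Lemma continuous_complex (f : T -> R[i]) :
  continuous (fun x => complex.Re (f x)) ->
  continuous (fun x => complex.Im (f x)) -> continuous (f : T -> R[i]^o).
Proof.
move=> cr ci x; apply/(@cvgrPdist_lt _ R[i]^o) => -[e1 e2].
rewrite ltcE/= => /andP[/eqP -> e0].
have e20 : 0 < e1 / 2 by rewrite divr_gt0.
near=> t; rewrite normr_normc ltcR (le_lt_trans (normc_le_ReIm _))//.
rewrite (splitr e1) ltrD//.
  have -> : complex.Re (f x - f t) = complex.Re (f x) - complex.Re (f t).
    by case: (f x) (f t) => ? ? [].
  by near: t; move/cvgrPdist_lt: (cr x); exact.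
have -> : complex.Im (f x - f t) = complex.Im (f x) - complex.Im (f t).
  by case: (f x) (f t) => ? ? [].
by near: t; move/cvgrPdist_lt: (ci x); exact.
Unshelve. all: by end_near. Qed.

Lemma continuous_Cb : continuous (h : T -> R).
Proof. by have := cbfunP h; rewrite inE => -[]. Qed.

Lemma mulCb_bounded : bounded_op (mulCb h).
Proof.
split=> [a u v|].
  by apply/val_inj/funext => x /=; rewrite [LHS]mulrDr mulrCA.
have := cbfunP h; rewrite inE => -[_ [N hN]].
exists `|N| => // u; rewrite !rnorm_Cb; apply: normCb_le.
  by rewrite mulr_ge0// normCb_ge0.
move=> x; rewrite [leLHS]normcM ler_pM ?normc_ge0 ?normCb_ge// normc_real.
by rewrite (le_trans (hN x))// ler_norm.
Qed.

Lemma mulCb_shift_invertible (z : R[i]) (e : R) : 0 < e ->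
  (forall x, e <= normc ((h x)%:C + z)) -> shift_invertible (mulCb h) z.
Proof.
move=> e0 he; have [cr ci] := cut_inverse_continuous z e0.
pose g x := cut_inverse z e (h x).
have cg : continuous (g : T -> R[i]^o).
  apply: continuous_complex => x.
    by apply: (@continuous_comp _ _ _ (h : T -> R)
      (fun t => complex.Re (cut_inverse z e t))); [exact: continuous_Cb|exact: cr].
  by apply: (@continuous_comp _ _ _ (h : T -> R)
    (fun t => complex.Im (cut_inverse z e t))); [exact: continuous_Cb|exact: ci].
have gP (u : CbC) : (fun x => g x * u x) \in @Cb_pred T R[i].
  have := cbfunP u; rewrite !inE => -[cu [M uM]]; split.
    by move=> x; apply: (@cvgM R[i]); [exact: cg|exact: cu].
  exists ((e^-1)%:C * M) => x; rewrite normrM ler_pM// normr_normc lecR.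
  exact: cut_inverse_bound.
exists (fun u => BCont (gP u)); split=> [|u|u].
- split=> [a u v|]; first by apply/val_inj/funext => x /=; rewrite [LHS]mulrDr mulrCA.
  exists e^-1 => [|u]; first by rewrite invr_ge0 ltW.
  rewrite !rnorm_Cb; apply: normCb_le.
    by rewrite mulr_ge0 ?normCb_ge0// invr_ge0 ltW.
  move=> x; rewrite [leLHS]normcM ler_pM ?normc_ge0 ?normCb_ge//.
  exact: cut_inverse_bound.
- apply/val_inj/funext => x; rewrite /= -[LHS]/(g x * ((h x)%:C * u x + z * u x)).
  by rewrite -mulrDl mulrA cut_inverseK// mul1r.
apply/val_inj/funext => x.
rewrite /= -[LHS]/((h x)%:C * (g x * u x) + z * (g x * u x)).
by rewrite -mulrDl mulrA [_ * g x]mulrC cut_inverseK// mul1r.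
Qed.

Lemma continuous_mdist (c : T) : continuous (mdist c : T -> R).
Proof.
move=> x; apply/cvgrPdist_lt => e e0; apply/nbhs_ballP; exists e => //= y.
rewrite ballEmdist /= => xy; rewrite (le_lt_trans _ xy)// ler_norml.
have := metric_triangle c y x; have := metric_triangle c x y.
by rewrite (metric_sym y x); lra.
Qed.

(** The hypothesis on level sets makes the open set where [h] is within [e] of
    [- r] infinite, so it carries bump functions with disjoint supports. *)
Lemma Cb_separated_near_kernel (r e : R) (N : nat) : no_finite_level mu h ->
  closure (range (fun x => - h x)) r -> 0 < e -> exists u : nat -> CbC,
  (forall i, (i <= N)%N -> rnorm (u i) = 1 /\
    rnorm (mulCb h (u i) + r%:C *: u i) <= e) /\
  (forall i j, (i < j)%N -> (j <= N)%N -> 1 <= rnorm (u j - u i)).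
Proof.
move=> nf hr e0; pose B := h @^-1` ball (- r) e.
have oB : open B.
  apply: open_comp; first by move=> x _; exact: continuous_Cb.
  exact: ball_open.
have [_ [[x0 _ <-]]] := hr (ball r e) (nbhsx_ballx r e e0).
rewrite -ball_normE /= => hx0.
have Bx0 : B x0 by rewrite /B -ball_normE /= -normrN opprD !opprK -[h x0]opprK.
have Bpos : (0 < mu B)%E.
  have /nbhs_ballP[s /= s0 sB] := open_nbhs_nbhs (conj oB Bx0).
  have /andP[pos _] := mm_ball hmu x0 s0; apply: (lt_le_trans pos).
  apply: le_measure => //; apply: mem_set; last exact: (mm_borel hmu).
  exact: (measurable_metric_ball hmu).
have iB : infinite_set B.
  move=> fB; apply: (nf _ _ e0 Bpos); exists B; split=> //.
  by rewrite setDv; exact: negligible_set0.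
have [x Bx [r0 r00 dis]] := infinite_disjoint_balls N iB.
have /choice[s sB] i : exists s : R, 0 < s /\ ball (x i) s `<=` B.
  by have /nbhs_ballP[s /= s0 sB] := open_nbhs_nbhs (conj oB (Bx i)); exists s.
have [s' s'0 s's] := finite_pos_lower_bound N (fun i => (sB i).1).
pose q := Num.min r0 s'; have q0 : 0 < q by rewrite lt_min r00.
pose b i y : R := Num.max (1 - mdist (x i) y / q) 0.
have b0 i y : 0 <= b i y by rewrite le_max lexx orbT.
have b1 i y : b i y <= 1.
  by rewrite ge_max ler01 andbT gerBl divr_ge0 ?mdist_ge0// ltW.
have bx i : b i (x i) = 1 by rewrite /b mdistxx mul0r subr0 max_l.
have bout i y : ~ ball (x i) q y -> b i y = 0.
  rewrite ballEmdist /= => /negP; rewrite -leNgt => qy.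
  by rewrite /b max_r// subr_le0 ler_pdivlMr// mul1r.
have bP i : (fun y => (b i y)%:C) \in @Cb_pred T R[i].
  rewrite inE; split.
    apply: continuous_complex => /= y; last exact: cvg_cst.
    apply: continuous_maxr => {}y; apply: cvgB; first exact: cvg_cst.
    by apply: cvgM; [exact: continuous_mdist|exact: cvg_cst].
  exists 1 => y; rewrite normr_normc normc_real ger0_norm//.
  by rewrite -[1]/(1%:C) lecR.
pose u i : CbC := BCont (bP i).
have nb i y : normc (u i y) = b i y by rewrite normc_real ger0_norm.
have u1 i : rnorm (u i) = 1.
  rewrite rnorm_Cb; apply/le_anti/andP; split.
    by apply: normCb_le => // y; rewrite nb.
  by rewrite -(bx i) -nb normCb_ge.
exists u; split=> [i iN|i j ij jN]; first split=> //.
  rewrite rnorm_Cb; apply: normCb_le => [|y]; first exact: ltW.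
  rewrite -[X in normc X]/((h y)%:C * u i y + r%:C * u i y) -mulrDl normcM nb.
  have [yB|/bout ->] := pselect (ball (x i) q y); last by rewrite mulr0 ltW.
  have By : B y.
    by apply: (sB i).2; apply: le_ball yB; rewrite ge_min (s's i iN) orbT.
  have hy : `|h y + r| < e.
    by move: By; rewrite /B -ball_normE /= -normrN opprD !opprK addrC.
  by rewrite -rmorphD normc_real -[leRHS]mulr1 ler_pM// ltW.
rewrite rnorm_Cb (le_trans _ (normCb_ge _ (x j)))//.
rewrite -[X in normc X]/(u j (x j) - u i (x j)).
have -> : u i (x j) = 0.
  rewrite /u /= bout// => xij; apply: (dis i j (x j) ij jN).
    by apply: le_ball xij; rewrite ge_min lexx.
  exact: ballxx.
by rewrite subr0 nb bx.
Qed.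

Theorem Cb_spectrum_description (K : {linear CbC -> CbC}) :
  no_finite_level mu h -> continuous K -> compact_operator K ->
  spectrum_description (fun u => K u - mulCb h u)
    (closure (range (fun x => - h x))).
Proof.
move=> nf cK kK.
have [U [UU Uoo]] := ultraFilterLemma (F := \oo) _.
have bK := continuous_bounded_op cK.
have uK := compact_operator_ulim UU kK.
apply: (compact_minus_multiplication_spectrum UU Uoo bK uK mulCb_bounded).
- move=> z nz; have [Iz|Iz] := eqVneq (complex.Im z) 0; last first.
    apply: (mulCb_shift_invertible (e := `|complex.Im z|)).
      by rewrite normr_gt0.
    move=> x; have := Im_le_normc ((h x)%:C + z).
    by case: (z) => a b /=; rewrite add0r.
  have zE : z = (complex.Re z)%:C by move: Iz; case: (z) => a b /= ->.
  have [e e0 ze] : exists2 e : R, 0 < e &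
      forall x, ~ ball (complex.Re z) e (- h x).
    apply: contrapT => H'; apply: nz; exists (complex.Re z) => // A.
    move=> /nbhs_ballP[e /= e0 eA]; apply: contrapT => nA; apply: H'.
    exists e => // x zx; apply: nA; exists (- h x); split; last exact: eA.
    by exists x.
  apply: (mulCb_shift_invertible e0) => x.
  rewrite zE -rmorphD normc_real leNgt; apply/negP => lt; apply: (ze x).
  by rewrite -ball_normE /= opprK addrC.
- exact: closed_closure.
- move=> _ [r rR <-].
  apply: (approximate_spectrum UU Uoo bK uK mulCb_bounded) => e N e0.
  exact: Cb_separated_near_kernel.
Qed.

End Cb_spectrum.

(** * The theorem *)

Theorem theorem3p26 (R : realType) (d : measure_display)
    (T : metricMeasurableType R d) (mu : {measure set T -> \bar R})
    (hmu : metric_measure mu) :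
  (forall (p : \bar R) (p1 : (1 <= p)%E) (h : LfunType mu (leey 1))
      (K : {linear LpC mu p1 -> LpC mu p1}),
    no_finite_level mu h -> continuous K -> compact_operator K ->
    spectrum_description (fun u => K u - mulLp h u)
      (ess_range mu (fun x => - h x))) /\
  (forall (h : Cb T R) (K : {linear Cb T R[i] -> Cb T R[i]}),
    no_finite_level mu h -> continuous K -> compact_operator K ->
    spectrum_description (fun u => K u - mulCb h u)
      (closure (range (fun x => - h x)))).
Proof.
split=> [p p1 h K nf cK kK|h K nf cK kK].
  exact: Lp_spectrum_description.
exact: (Cb_spectrum_description hmu).
Qed.
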